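(* Let $A>0$, $\sigma=0$, and $p(x)=\frac12e^{-|x|}$. Set $A_1=\frac{-A+\sqrt{A^2+4}}{2}$ and $A_2=\frac{-A-\sqrt{A^2+4}}{2}$. The system $$u_t-u_{txx}-Au_x+3uu_x+(1+\eta)\eta_x=0,\qquad \eta_t+\big((1+\eta)u\big)_x=0$$ admits a solitary wave of speed $c\in\mathbb{R}$ if and only if $c>A_1$ or $c<A_2$. Moreover, every solitary wave $(\varphi,\eta)$ of this system is smooth, i.e. $\varphi,\eta\in C^\infty(\mathbb{R})$.
   Context: A solitary wave of speed $c$ is a pair $(\varphi,\eta)\in H^1(\mathbb{R})\times H^1(\mathbb{R})$, not identically zero, with $\varphi,\eta\to0$ as $|x|\to\infty$, such that in $\mathcal{D}'(\mathbb{R})$ $$\Big[-c\varphi+p\ast\Big(-A\varphi+\tfrac{3}{2}\varphi^2+\tfrac12(1+\eta)^2\Big)\Big]_x=0,\qquad \big[-c\eta+(1+\eta)\varphi\big]_x=0,$$ i.e. $(u,\eta)(t,x)=(\varphi(x-ct),\eta(x-ct))$ is a weak traveling-wave solution. *)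

(* Defs.v *)
From HB Require Import structures.
From mathcomp Require Import all_boot all_order all_algebra.
From mathcomp Require Import all_classical all_reals all_analysis.
Set Implicit Arguments. Unset Strict Implicit. Unset Printing Implicit Defensive.
Import Order.TTheory GRing.Theory Num.Theory.
Import numFieldNormedType.Exports.
Local Open Scope classical_set_scope.
Local Open Scope ring_scope.

Section Defs.
Variable R : realType.
Local Notation mu := (@lebesgue_measure R).

Definition smooth (f : R -> R) : Prop :=
  forall (n : nat) (x : R), derivable (derive1n n f) x 1.

Definition test_fun (psi : R -> R) : Prop :=
  smooth psi /\ exists M : R, forall x : R, M < `|x| -> psi x = 0.

Definition integral_R (f : R -> R) : R := \int[mu]_(x in [set: R]) f x.

Definition L2 (f : R -> R) : Prop :=
  mu.-integrable [set: R] (fun x => ((f x) ^+ 2)%:E) /\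
  measurable_fun [set: R] f.

Definition weak_deriv (f g : R -> R) : Prop :=
  forall psi, test_fun psi ->
    integral_R (fun x => f x * derive1 psi x) = - integral_R (fun x => g x * psi x).

(* H^1(R), with functions taken as their continuous representative *)
Definition H1 (f : R -> R) : Prop :=
  continuous f /\ L2 f /\ exists g, L2 g /\ weak_deriv f g.

Definition dderiv_zero (F : R -> R) : Prop :=
  forall psi, test_fun psi -> integral_R (fun x => F x * derive1 psi x) = 0.

Definition pker (x : R) : R := expR (- `|x|) / 2.

Definition conv (p g : R -> R) (x : R) : R := integral_R (fun y => p (x - y) * g y).

Definition vanishes_at_infty (f : R -> R) : Prop :=
  f x @[x --> +oo] --> 0 /\ f x @[x --> -oo] --> 0.

Definition solitary_wave (A c : R) (phi eta : R -> R) : Prop :=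
  H1 phi /\ H1 eta /\
      (exists x, phi x != 0 \/ eta x != 0) /\
      vanishes_at_infty phi /\ vanishes_at_infty eta /\
      dderiv_zero (fun x => - c * phi x +
         conv pker (fun y => - A * phi y + 3 / 2 * (phi y) ^+ 2
                                + 1 / 2 * (1 + eta y) ^+ 2) x) /\
      dderiv_zero (fun x => - c * eta x + (1 + eta x) * phi x).

End Defs.

(* Main.v *)
(** The convolution kernel [pker] is the Green function of [1 - d^2/dx^2], and a
continuous function with zero distributional derivative is constant. Hence a
solitary wave satisfies [eta (c - phi) = phi] and the pointwise equation
[c (phi - phi'') = - A phi + 3/2 phi^2 + c^2 / (2 (c - phi)^2) - 1/2] with
[c <> 0] and [c (c - phi) > 0]; bootstrapping this equation gives smoothness.
Its first integral is
  [c (c - phi) phi'^2 = phi^2 (c - phi - A1) (c - phi - A2)].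
The symmetry [(A, c, phi, eta) -> (- A, - c, - phi, eta)] reduces everything to
[c > 0]. By Gronwall a nontrivial [phi] never vanishes, so [phi <= c - A1]
everywhere, and [c <= A1] would force the negative minimum of [phi] to be its
upper bound [c - A1], against the decay at infinity. Conversely, for [c > A1]
the first integral is solved by quadrature, with crest height [c - A1]. *)

(* The source of the convolution tends to 1/2 at infinity, so it is bounded but not square
   integrable. The convolution is therefore identified as the bounded solution of v - v'' = g, which
   yields its derivatives without differentiating under the integral sign.

   A solitary wave comes with decay of phi but with no pointwise decay of phi', and without the
   latter the constant of the first integral is unknown. Both gaps close together: phi'' is a
   continuous expression in phi, eta and an integration constant [K], so it has a limit at infinity.
   Since phi tends to 0, this limit must be 0, which fixes K = 1/2 and forces phi' to tend to 0.

   The thresholds are the roots of s^2 + A s - 1, taken at s = c - phi. At infinity s equals c, and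
   the first integral keeps s out of the gap between the roots.

   For existence, the obstacle is the crest. There the square root of the first integral is not
   Lipschitz, and the constant c - A1 is a competing solution of the first-order equation. A
   substitution has to remove this singularity before separation of variables applies. *)
Require Import Defs.
From HB Require Import structures.
From mathcomp Require Import all_boot all_order all_algebra.
From mathcomp Require Import all_classical all_reals all_analysis.
From mathcomp Require Import measurable_realfun ring lra.
Set Implicit Arguments. Unset Strict Implicit. Unset Printing Implicit Defensive.
Import Order.TTheory GRing.Theory Num.Theory.
Import numFieldNormedType.Exports.
Local Open Scope classical_set_scope.
Local Open Scope ring_scope.

(** * Derivatives and primitives *)

Section RealDerivatives.
Variable R : realType.
Implicit Types (f g df dg : R -> R) (x a b c : R).
Local Notation mu := (@lebesgue_measure R).

(* Unlike [is_derive], not a type class: instance resolution would otherwise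
   interfere with backward reasoning. *)
Definition has_der x f a : Prop := is_derive x 1 f a.

Lemma derC c x : has_der x (fun _ : R => c) 0.
Proof. exact: is_derive_cst. Qed.

Lemma derId x : has_der x (fun t : R => t) 1.
Proof. exact: is_derive_id. Qed.

Lemma derD f g x a b : has_der x f a -> has_der x g b ->
  has_der x (fun t => f t + g t) (a + b).
Proof. by move=> fa gb; exact: is_deriveD. Qed.

Lemma derN f x a : has_der x f a -> has_der x (fun t => - f t) (- a).
Proof. by move=> fa; exact: is_deriveN. Qed.

Lemma derB f g x a b : has_der x f a -> has_der x g b ->
  has_der x (fun t => f t - g t) (a - b).
Proof. by move=> fa gb; exact: is_deriveB. Qed.

Lemma derM f g x a b : has_der x f a -> has_der x g b ->
  has_der x (fun t => f t * g t) (a * g x + f x * b).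
Proof.
move=> fa gb; have := is_deriveM fa gb.
by rewrite /GRing.scale /= addrC [g x * a]mulrC.
Qed.

Lemma derX f x a n : has_der x f a ->
  has_der x (fun t => f t ^+ n) (n%:R * f x ^+ n.-1 * a).
Proof.
move=> fa; have -> : (fun t => f t ^+ n) = f ^+ n by rewrite exprfctE.
exact: is_deriveX.
Qed.

Lemma derV f x a : f x != 0 -> has_der x f a ->
  has_der x (fun t => (f t)^-1) (- a / f x ^+ 2).
Proof.
move=> f0 fa; have := is_deriveV f0 fa.
by rewrite /GRing.scale /= !mulNr mulrC.
Qed.

Lemma der_comp f g x a b : has_der (f x) g b -> has_der x f a ->
  has_der x (fun t => g (f t)) (b * a).
Proof. by move=> gb fa; exact: is_derive1_comp. Qed.

Lemma der_expR f x a : has_der x f a ->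
  has_der x (fun t => expR (f t)) (expR (f x) * a).
Proof. by move=> fa; apply: (der_comp _ fa); exact: is_derive_expR. Qed.

Lemma der_eq f x a b : has_der x f a -> a = b -> has_der x f b.
Proof. by move=> fa <-. Qed.

Lemma derE f x a : has_der x f a -> derive1 f x = a.
Proof. by move=> fa; rewrite derive1E; apply: derive_val. Qed.

Lemma derP f x : derivable f x 1 -> has_der x f (derive1 f x).
Proof. by move=> fx; rewrite /has_der derive1E; exact: derivableP. Qed.

Lemma der_derivable f x a : has_der x f a -> derivable f x 1.
Proof. by move=> [? _]. Qed.

Lemma der_continuous f x a : has_der x f a -> {for x, continuous f}.
Proof.
by move=> [fx _]; apply/differentiable_continuous/derivable1_diffP.
Qed.

Lemma ders_continuous f df : (forall x, has_der x f (df x)) -> continuous f.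
Proof. by move=> fdf x; exact: der_continuous (fdf x). Qed.

Lemma continuousM_fun f g : continuous f -> continuous g ->
  continuous (fun x => f x * g x).
Proof. by move=> cf cg x; exact: (continuousM (cf x) (cg x)). Qed.

Lemma continuousD_fun f g : continuous f -> continuous g ->
  continuous (fun x => f x + g x).
Proof. by move=> cf cg x; exact: (continuousD (cf x) (cg x)). Qed.

Lemma der_mvt f df a b : a < b -> (forall x, has_der x f (df x)) ->
  exists c, [/\ a < c, c < b & f b - f a = df c * (b - a)].
Proof.
move=> ab fdf.
have [c] := MVT (df := df) ab (fun x _ => fdf x)
  (continuous_subspaceT (ders_continuous fdf)).
by rewrite in_itv /= => /andP[ac cb] e; exists c.
Qed.

Lemma der_ge0_nondecreasing f df : (forall x, has_der x f (df x)) ->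
  (forall x, 0 <= df x) -> forall x y, x <= y -> f x <= f y.
Proof.
move=> fdf df0 x y; rewrite le_eqVlt => /predU1P[->//|xy].
have [c [_ _ e]] := der_mvt xy fdf.
by rewrite -subr_ge0 e mulr_ge0// subr_ge0 ltW.
Qed.

Lemma der_eq0_cst f : (forall x, has_der x f 0) -> forall x y, f x = f y.
Proof. by move=> f0 x y; exact: is_derive_0_is_cst. Qed.

Lemma continuous_integrable_itv f (i j : bool) a b : continuous f ->
  mu.-integrable [set` Interval (BSide i a) (BSide j b)] (EFin \o f).
Proof.
move=> cf; apply: (@integrableS _ _ _ mu `[a, b]%classic) => //=.
  by apply: subset_itv; rewrite bnd_simp; case: i; case: j.
apply: continuous_compact_integrable; first exact: segment_compact.
exact: continuous_subspaceT.
Qed.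

(** An integral from a fixed base point is a primitive only to the right of that point. The base
    -|x| - 1 lies left of both 0 and x, and subtracting the value at 0 removes the dependence on the
    base ([FB]), so one formula serves the whole line. *)
Lemma antiderivative f : continuous f ->
  exists F, forall x, has_der x F (f x).
Proof.
move=> cf.
pose F (b x : R) := (\int[mu]_(t in `]b, x]) f t)%R.
have FB (b b' x : R) : b' <= b -> b <= 0 -> b <= x ->
    F b x - F b 0 = F b' x - F b' 0.
  move=> b'b b0 bx.
  have key y : b <= y -> F b y = F b' y - F b' b.
    move=> bY; rewrite /F -(@Rintegral_itvB _ f (BRight b') (BRight y) b) ?bnd_simp//.
    exact: continuous_integrable_itv.
  by rewrite !key//; ring.
pose G (x : R) := F (- `|x| - 1) x - F (- `|x| - 1) 0.
(* One unit below the base used at [x], so that [b] also lies below -|y| - 1 for every y within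
   distance 1 of [x]. *)
exists G => x; pose b : R := - `|x| - 2.
have bx : b < x by have := ler_norm (- x); rewrite normrN /b; lra.
have : has_der x (fun y => F b y - F b 0) (f x).
  suff h : has_der x (F b) (f x).
    by have := derB h (derC (F b 0) x); rewrite subr0.
  have xu : x < x + 1 by lra.
  have bx' : (BRight b < BRight x)%O by rewrite bnd_simp.
  have [dF eF] := continuous_FTC1 xu
    (continuous_integrable_itv false false b (x + 1) cf) bx' (cf x).
  by rewrite -eF; exact: derP.
rewrite /has_der; apply: near_eq_is_derive; near=> y; rewrite /G.
have yx : `|y - x| < 1 by near: y; apply: cvgr_distC_lt => //; exact: cvg_id.
have h1 : `|y| <= `|x| + `|y - x|.
  by rewrite -{1}(subrK x y) addrC; exact: ler_normD.
have h2 : - `|y| <= y by rewrite lerNl -normrN ler_norm.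
have h3 : 0 <= `|y| by [].
by apply/esym/FB; rewrite /b; lra.
Unshelve. all: by end_near. Qed.

End RealDerivatives.

(** * The Green function of 1 - d^2/dx^2 *)

Section GreenFunction.
Variable R : realType.
Implicit Types (f g v w : R -> R) (x y C M : R).
Local Notation mu := (@lebesgue_measure R).

Lemma continuous_oppr f : continuous f -> continuous (fun x => f (- x)).
Proof.
move=> cf x; apply: (@continuous_comp _ _ _ -%R f); last exact: cf.
exact: opp_continuous.
Qed.

Lemma der_oppr f x a : has_der (- x) f a ->
  has_der x (fun t => f (- t)) (- a).
Proof. by move=> fa; have := der_comp fa (derN (derId x)); rewrite mulrN1. Qed.

(* The solution is the exponentially weighted primitive of [g] from [-oo]. *)
Lemma relaxation_solution g M : continuous g -> (forall x, 0 <= g x <= M) ->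
  exists w, (forall x, has_der x w (g x - w x)) /\
            (forall x, 0 <= w x <= M).
Proof.
move=> cg g0M.
have [a ha] := antiderivative (continuousM_fun (@continuous_expR R) cg).
have a_nd : forall x y, x <= y -> a x <= a y.
  apply: der_ge0_nondecreasing ha _ => x.
  by rewrite mulr_ge0 ?expR_ge0//; have /andP[] := g0M x.
have b_nd : forall x y, x <= y -> M * expR x - a x <= M * expR y - a y.
  apply: (@der_ge0_nondecreasing _ (fun x => M * expR x - a x)
    (fun x => 0 * expR x + M * expR x - expR x * g x)) => x.
    apply: derB (ha x); apply: derM; first exact: derC.
    exact: is_derive_expR.
  rewrite mul0r add0r mulrC -mulrBr.
  by rewrite mulr_ge0 ?expR_ge0// subr_ge0; have /andP[] := g0M x.
have M0 : 0 <= M by have /andP[h1 h2] := g0M 0; exact: le_trans h2.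
have ab x y : y <= x -> a x - M * expR x <= a y.
  move=> yx; have h := b_nd _ _ yx; have := mulr_ge0 M0 (expR_ge0 y); lra.
have lb : has_lbound (range a).
  exists (a 0 - M * expR 0) => _ [y _ <-].
  have [y0|/ltW y0] := leP y 0; first exact: ab.
  by have := a_nd _ _ y0; have := mulr_ge0 M0 (expR_ge0 (0 : R)); lra.
(* As [a] is nondecreasing, [l] is its limit at -oo, and [a x - l] stands for the integral of
   [expR * g] from -oo to [x]. *)
pose l := inf (range a).
have la x : l <= a x by apply: ge_inf => //; exists x.
have al x : a x - M * expR x <= l.
  apply: lb_le_inf; first by exists (a 0), 0.
  move=> _ [y _ <-]; have [yx|/ltW yx] := leP y x; first exact: ab.
  by have := a_nd _ _ yx; have := mulr_ge0 M0 (expR_ge0 x); lra.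
exists (fun x => expR (- x) * (a x - l)); split => x.
  apply: der_eq.
    apply: derM; first exact/der_expR/derN/derId.
    by apply: derB; [exact: ha|exact: derC].
  rewrite subr0 mulrA -expRD addNr expR0; ring.
apply/andP; split; first by rewrite mulr_ge0 ?expR_ge0// subr_ge0.
rewrite expRN mulrC ler_pdivrMr ?expR_gt0//; have := al x; lra.
Qed.

(** In the variable y, - expR (x - y) * w y is a primitive of the integrand. It tends to 0 at +oo
    because [w] is bounded, so only its value at y = x survives. *)
Lemma ge0_integral_expR_right g w C x : continuous g -> (forall y, 0 <= g y) ->
  (forall y, has_der y w (w y - g y)) -> (forall y, `|w y| <= C) ->
  (\int[mu]_(y in `[x, +oo[) (expR (x - y) * g y)%:E)%E = (w x)%:E.
Proof.
move=> cg g0 hw wC.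
pose F y := - (expR (x - y) * w y).
have hF y : has_der y F (expR (x - y) * g y).
  apply: der_eq.
    apply/derN/derM; last exact: hw.
    by apply: der_expR; apply: derB; [exact: derC|exact: derId].
  by rewrite /=; ring.
have cF : continuous F by exact: ders_continuous hF.
rewrite (@ge0_continuous_FTC2y _ _ F x 0).
- by rewrite sub0e -EFinN /F subrr expR0 mul1r opprK.
- by move=> y _; rewrite mulr_ge0 ?expR_ge0.
- apply/continuous_subspaceT/continuousM_fun => // y.
  apply: (@continuous_comp _ _ _ (fun y => x - y) expR).
    by apply: continuousB; [exact: cvg_cst|exact: cvg_id].
  exact: continuous_expR.
- have lim0 (k : R) : k * expR (- y) @[y --> +oo] --> 0.
    rewrite -(mulr0 k); apply: cvgM; first exact: cvg_cst.
    exact: cvgr_expR.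
  apply: (squeeze_cvgr _ (lim0 (- (expR x * C))) (lim0 (expR x * C))).
  apply: nearW => y; rewrite mulNr -ler_norml normrN normrM ger0_norm ?expR_ge0//.
  by rewrite expRD mulrAC ler_wpM2r ?expR_ge0// ler_wpM2l ?expR_ge0.
- by move=> y _; exact: der_derivable (hF y).
- exact/cvg_at_right_filter/cF.
- by move=> y _; exact: derE.
Qed.

Lemma ge0_integral_expR_left g w C x : continuous g -> (forall y, 0 <= g y) ->
  (forall y, has_der y w (g y - w y)) -> (forall y, `|w y| <= C) ->
  (\int[mu]_(y in `]-oo, x]) (expR (y - x) * g y)%:E)%E = (w x)%:E.
Proof.
move=> cg g0 hw wC; rewrite -{1 3}(opprK x).
rewrite ge0_integration_by_substitutionNy.
- have <- := @ge0_integral_expR_right (fun y => g (- y)) (fun y => w (- y)) C (- x).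
  + by apply: eq_integral => y _ /=; rewrite (addrC (- y)).
  + exact: continuous_oppr.
  + by move=> y.
  + by move=> y; apply: der_eq; [exact/der_oppr/hw|rewrite opprB].
  + by move=> y.
- apply/continuous_subspaceT/continuousM_fun => // y.
  apply: (@continuous_comp _ _ _ (fun y => y - x) expR).
    by apply: continuousB; [exact: cvg_id|exact: cvg_cst].
  exact: continuous_expR.
- by move=> y _; rewrite mulr_ge0 ?expR_ge0.
Qed.

Lemma continuous_pker : continuous (@pker R).
Proof.
rewrite /pker; apply: continuousM_fun => x; last exact: cvg_cst.
apply: (@continuous_comp _ _ _ (fun x => - `|x|) expR); last exact: continuous_expR.
by apply: continuousN; exact: norm_continuous.
Qed.

Lemma pker_ge0 x : 0 <= pker x.
Proof. by rewrite /pker divr_ge0// expR_ge0. Qed.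

Lemma continuous_pker_mul g x : continuous g ->
  continuous (fun y => pker (x - y) * g y).
Proof.
move=> cg; apply: continuousM_fun => // y.
apply: (@continuous_comp _ _ _ (fun y => x - y) (@pker R)).
  by apply: continuousB; [exact: cvg_cst|exact: cvg_id].
exact: continuous_pker.
Qed.

(** The operator 1 - d^2/dx^2 factors into two first-order operators: (v - v')/2 and (v + v')/2
    solve the left and right relaxation equations with source g/2. They are the two halves of the
    integral, cut at the kink [x] of the kernel. *)
Lemma ge0_integral_pker g v v1 C x : continuous g -> (forall y, 0 <= g y) ->
  (forall y, has_der y v (v1 y)) ->
  (forall y, has_der y v1 (v y - g y)) ->
  (forall y, `|v y| <= C) -> (forall y, `|v1 y| <= C) ->
  (\int[mu]_(y in [set: R]) (pker (x - y) * g y)%:E)%E = (v x)%:E.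
Proof.
move=> cg g0 hv hv1 vC v1C.
have mh : measurable_fun [set: R] (fun y => pker (x - y) * g y).
  by apply: continuous_measurable_fun; exact: continuous_pker_mul.
have cg2 : continuous (fun y => g y / 2).
  by apply: continuousM_fun => // y; exact: cvg_cst.
have g20 y : 0 <= g y / 2 by rewrite divr_ge0.
rewrite -(itv_setU_setT false x) ge0_integral_setU//=; last 3 first.
- by rewrite itv_setU_setT; exact/measurable_EFinP.
- by move=> y _; rewrite lee_fin mulr_ge0 ?pker_ge0.
- apply/disj_setPS => y /= []; rewrite !in_itv /= andbT => yx xy.
  by have := lt_le_trans xy yx; rewrite ltxx.
rewrite integral_itv_obnd_cbnd; last exact/measurable_EFinP/measurable_funTS.
have -> : (\int[mu]_(y in `]-oo, x]) (pker (x - y) * g y)%:E)%E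
    = ((v x - v1 x) / 2)%:E.
  rewrite -(@ge0_integral_expR_left (fun y => g y / 2)
    (fun y => (v y - v1 y) / 2) (C + C) x cg2 g20).
  - apply: eq_integral => y; rewrite inE /= in_itv /= => yx.
    by rewrite /pker ger0_norm ?subr_ge0// opprB mulrAC mulrA.
  - move=> y; apply: der_eq.
      apply: derM; last exact: derC.
      by apply: derB; [exact: hv|exact: hv1].
    by rewrite /=; field.
  - move=> y; rewrite normrM normfV [`|2|]ger0_norm//.
    have := ler_normB (v y) (v1 y); have := vC y; have := v1C y.
    have := normr_ge0 (v y - v1 y); lra.
have -> : (\int[mu]_(y in `[x, +oo[) (pker (x - y) * g y)%:E)%E
    = ((v x + v1 x) / 2)%:E.
  rewrite -(@ge0_integral_expR_right (fun y => g y / 2)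
    (fun y => (v y + v1 y) / 2) (C + C) x cg2 g20).
  - apply: eq_integral => y; rewrite inE /= in_itv /= andbT => yx.
    by rewrite /pker ler0_norm ?subr_le0// opprK mulrAC mulrA.
  - move=> y; apply: der_eq.
      apply: derM; last exact: derC.
      by apply: derD; [exact: hv|exact: hv1].
    by rewrite /=; field.
  - move=> y; rewrite normrM normfV [`|2|]ger0_norm//.
    have := ler_normD (v y) (v1 y); have := vC y; have := v1C y.
    have := normr_ge0 (v y + v1 y); lra.
by rewrite -EFinD; congr EFin; field.
Qed.

(* [pker] is the Green function of [1 - d^2/dx^2]; the sign condition needed by
   the monotone form of the fundamental theorem of calculus is removed by
   adding a constant, which [1 - d^2/dx^2] fixes. *)
Lemma conv_pker_green g v v1 M C : continuous g -> (forall y, `|g y| <= M) ->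
  (forall y, has_der y v (v1 y)) ->
  (forall y, has_der y v1 (v y - g y)) ->
  (forall y, `|v y| <= C) -> (forall y, `|v1 y| <= C) ->
  forall x, Defs.conv (@pker R) g x = v x.
Proof.
move=> cg gM hv hv1 vC v1C x.
have M0 : 0 <= M by exact: le_trans (gM 0).
have C0 : 0 <= C by exact: le_trans (vC 0).
have cM : continuous (fun _ : R => M) by move=> y; exact: cvg_cst.
have cgM : continuous (fun y => g y + M) by exact: continuousD_fun.
have gM0 y : 0 <= g y + M by have := gM y; rewrite ler_norml; lra.
have I1 := @ge0_integral_pker (fun y => g y + M) (fun y => v y + M) v1 (C + M)
  x cgM gM0.
have I2 := @ge0_integral_pker (fun=> M) (fun=> M) (fun=> 0) M x cM (fun=> M0).
have {}I1 : (\int[mu]_(y in [set: R]) (pker (x - y) * (g y + M))%:E)%E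
    = (v x + M)%:E.
  apply: I1 => y.
  - by rewrite -[v1 y]addr0; apply: derD; [exact: hv|exact: derC].
  - by have -> : v y + M - (g y + M) = v y - g y by ring.
  - by rewrite (le_trans (ler_normD _ _))// lerD// ger0_norm.
  - by rewrite (le_trans (v1C y))// lerDl.
have {}I2 : (\int[mu]_(y in [set: R]) (pker (x - y) * M)%:E)%E = M%:E.
  apply: I2 => y.
  - exact: derC.
  - by rewrite subrr; exact: derC.
  - by rewrite ger0_norm.
  - by rewrite normr0.
have int (h : R -> R) (r : R) : continuous h -> (forall y, 0 <= h y) ->
    (\int[mu]_(y in [set: R]) (pker (x - y) * h y)%:E)%E = r%:E ->
    mu.-integrable [set: R] (EFin \o (fun y => pker (x - y) * h y)).
  move=> ch h0 hr; apply/integrableP; split.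
    apply/measurable_EFinP; apply: continuous_measurable_fun.
    exact: continuous_pker_mul.
  rewrite (_ : (\int[mu]_(y in _) _)%E = r%:E) ?ltry// -hr.
  apply: eq_integral => y _ /=.
  by rewrite ger0_norm// mulr_ge0 ?pker_ge0.
rewrite /Defs.conv /integral_R.
under eq_Rintegral do rewrite -[X in _ * X](addrK M) mulrBr.
rewrite (RintegralB (@measurableT _ _) (int _ _ cgM gM0 I1)
  (int _ _ cM (fun=> M0) I2)).
by rewrite /Rintegral I1 I2 /= addrK.
Qed.

(** A bounded solution is assembled from two one-sided relaxations, one for the source and one for
    its reflection, and [conv_pker_green] identifies it with the convolution. Shifting by [M] makes
    the source nonnegative. *)
Lemma conv_pker_derivatives g M : continuous g -> (forall y, `|g y| <= M) ->
  exists v1, (forall x, has_der x (Defs.conv (@pker R) g) (v1 x)) /\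
             (forall x, has_der x v1 (Defs.conv (@pker R) g x - g x)).
Proof.
move=> cg gM.
have M0 : 0 <= M by exact: le_trans (gM 0).
pose h y := g y + M.
have ch : continuous h by apply: continuousD_fun => // y; exact: cvg_cst.
have h0 y : 0 <= h y <= M + M.
  by rewrite /h; have := gM y; rewrite ler_norml; lra.
have [w [hw w0M]] := relaxation_solution ch h0.
have [z [hz z0M]] := relaxation_solution (continuous_oppr ch) (fun y => h0 (- y)).
pose v y := (w y + z (- y)) / 2 - M.
pose v1 y := (z (- y) - w y) / 2.
have hz' y : has_der y (fun t => z (- t)) (z (- y) - h y).
  by apply: der_eq; [exact/der_oppr/hz|rewrite /= opprK opprB].
have hv y : has_der y v (v1 y).
  apply: der_eq.
    apply: derB; last exact: derC.
    apply: derM; last exact: derC.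
    by apply: derD; [exact: hw|exact: hz'].
  by rewrite /v1; field.
have hv1 y : has_der y v1 (v y - g y).
  apply: der_eq.
    apply: derM; last exact: derC.
    by apply: derB; [exact: hz'|exact: hw].
  by rewrite /v /h; field.
have vE : Defs.conv (@pker R) g = v.
  apply/funext; apply: (@conv_pker_green g v v1 M (M + M + M + M)) => // y;
  rewrite /v /v1 ler_norml; have := w0M y; have := z0M (- y); lra.
by exists v1; rewrite vE.
Qed.

End GreenFunction.

(** * Smooth functions and bumps *)

Section SmoothFunctions.
Variable R : realType.
Implicit Types (f g df : R -> R) (x y : R).

(** Differentiability [n] times, without continuity of the last derivative; peeling one derivative
    at a time makes the closure rules plain inductions. *)
Fixpoint Ck (n : nat) f : Prop :=
  if n is n'.+1 then (forall x, derivable f x 1) /\ Ck n' (derive1 f) else True.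

Lemma smoothP f : smooth f <-> forall n, Ck n f.
Proof.
split=> [sf n|cf n]; last first.
  elim: n f {cf}(cf n.+1) => [|n ih] f /= [df cdf] x; first exact: df.
  by have := ih _ cdf x; rewrite -derive1Sn.
elim: n f sf => [//|n ih] f sf /=; split; first exact: (sf 0%N).
by apply: ih => k x; have := sf k.+1 x; rewrite derive1Sn.
Qed.

Lemma Ck_der n f df : (forall x, has_der x f (df x)) -> Ck n df -> Ck n.+1 f.
Proof.
move=> fdf cdf; split=> [x|]; first exact: der_derivable (fdf x).
by rewrite (_ : derive1 f = df)//; apply/funext => x; exact: derE.
Qed.

Lemma CkS n f : Ck n.+1 f ->
  (forall x, has_der x f (derive1 f x)) /\ Ck n (derive1 f).
Proof. by move=> [df cf]; split=> // x; exact: derP. Qed.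

Lemma CkW n f : Ck n.+1 f -> Ck n f.
Proof. by elim: n f => [//|n ih] f [df cdf]; split=> //; exact: ih. Qed.

Lemma Ck_cst n (c : R) : Ck n (fun=> c).
Proof.
elim: n c => [//|n ih] c; apply: (@Ck_der _ _ (fun=> 0)) => //.
by move=> x; exact: derC.
Qed.

Lemma CkD n f g : Ck n f -> Ck n g -> Ck n (fun x => f x + g x).
Proof.
elim: n f g => [//|n ih] f g /CkS[df cdf] /CkS[dg cdg].
by apply: Ck_der (ih _ _ cdf cdg) => x; exact: derD.
Qed.

Lemma CkM n f g : Ck n f -> Ck n g -> Ck n (fun x => f x * g x).
Proof.
elim: n f g => [//|n ih] f g cf cg.
have [df cdf] := CkS cf; have [dg cdg] := CkS cg.
apply: Ck_der; first by move=> x; exact: derM.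
by apply: CkD; apply: ih => //; exact: CkW.
Qed.

Lemma CkN n f : Ck n f -> Ck n (fun x => - f x).
Proof.
move=> cf; rewrite (_ : (fun x => - f x) = (fun x => -1 * f x)).
  by apply: CkM => //; exact: Ck_cst.
by apply/funext => x; rewrite mulN1r.
Qed.

Lemma CkX n f k : Ck n f -> Ck n (fun x => f x ^+ k).
Proof.
move=> cf; elim: k => [|k ih]; first exact: Ck_cst.
rewrite (_ : (fun _ => _) = (fun x => f x * f x ^+ k)); first exact: CkM.
by apply/funext => x; rewrite exprS.
Qed.

Lemma CkV n f : (forall x, f x != 0) -> Ck n f -> Ck n (fun x => (f x)^-1).
Proof.
move=> f0; elim: n => [//|n ih] cf; have [df cdf] := CkS cf.
apply: (@Ck_der _ _ (fun x => - derive1 f x * ((f x)^-1 * (f x)^-1))).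
  by move=> x; apply: der_eq (derV (f0 x) (df x)) _; rewrite -invfM expr2.
apply: CkM; first exact: CkN.
by apply: CkM; apply: ih; exact: CkW.
Qed.

Lemma Ck_affine n f (a b : R) : Ck n f -> Ck n (fun x => f (a * x + b)).
Proof.
elim: n f => [//|n ih] f /CkS[df cdf].
apply: (@Ck_der _ _ (fun x => derive1 f (a * x + b) * a)) => [x|].
  apply: (@der_comp _ (fun x => a * x + b)); first exact: df.
  apply: der_eq; first by apply: derD; [apply: derM; [exact: derC|exact: derId]|exact: derC].
  by rewrite /=; ring.
by apply: CkM; [exact: ih|exact: Ck_cst].
Qed.

(** Termwise from t^i <= i! e^t, which explains the factorials in the witness. *)
Lemma horner_le_expR (p : {poly R}) :
  exists K, 0 <= K /\ forall t, 0 <= t -> `|p.[t]| <= K * expR t.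
Proof.
exists (\sum_(i < size p) `|p`_i| * i`!%:R); split.
  by apply: sumr_ge0 => i _; rewrite mulr_ge0.
move=> t t0; rewrite horner_coef mulr_suml.
apply: (le_trans (ler_norm_sum _ _ _)); apply: ler_sum => i _.
rewrite normrM -mulrA ler_wpM2l// normrX ger0_norm//.
case: (nat_of_ord i) => [|k].
  by rewrite expr0 mul1r (le_trans _ (expR_ge1Dx t))// lerDl.
rewrite mulrC -ler_pdivrMr ?ltr0n ?fact_gt0//.
by rewrite (le_trans _ (expR_ge1Dxn k t0))// lerDr.
Qed.

(** [flat 1] is the classical exp(-1/x) glued to 0. The polynomial factor in 1/x makes the family
    stable under differentiation, [p] becoming X^2 (p - p'). *)
Definition flat (p : {poly R}) x : R :=
  if 0 < x then p.[x^-1] * expR (- x^-1) else 0.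

Lemma flat_le0 p x : x <= 0 -> flat p x = 0.
Proof. by move=> x0; rewrite /flat ltNge x0. Qed.

(** The exponential bound is applied to X^2 p instead of p; this gains the factor x^2 that gives a
    zero derivative at the gluing point. *)
Lemma flat_bound p : exists K, 0 <= K /\ forall x, `|flat p x| <= K * x ^+ 2.
Proof.
have [K [K0 hK]] := horner_le_expR ('X^2 * p).
exists K; split=> // x; rewrite /flat; case: ifPn => [x0|_]; last first.
  by rewrite normr0 mulr_ge0// sqr_ge0.
have xV : 0 <= x^-1 by rewrite invr_ge0 ltW.
have := hK _ xV; rewrite hornerM hornerXn normrM [`|_ ^+ 2|]ger0_norm ?sqr_ge0//.
move=> h; rewrite normrM [`|expR _|]ger0_norm ?expR_ge0// expRN.
rewrite ler_pdivrMr ?expR_gt0// -(ler_pM2l (_ : 0 < x^-1 ^+ 2)); last first.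
  by rewrite exprn_gt0// invr_gt0.
rewrite (le_trans h)// le_eqVlt; apply/orP; left; apply/eqP.
by field; rewrite gt_eqF.
Qed.

Lemma has_der0_quadratic f (K : R) :
  (forall x, `|f x| <= K * x ^+ 2) -> has_der 0 f 0.
Proof.
move=> hf.
have f0 : f 0 = 0.
  by apply/normr0_eq0/eqP; rewrite eq_le normr_ge0 andbT (le_trans (hf 0))// expr0n mulr0.
(* The difference quotient; the convention 0^-1 = 0 already gives it the right value at 0. *)
apply/is_derive1_caratheodory; exists (fun z => f z / z); split.
- move=> z; rewrite f0 !subr0; have [->|z0] := eqVneq z 0.
    by rewrite f0 !mul0r.
  by rewrite divfK.
- rewrite /prop_for /continuous_at invr0 mulr0.
  have lim0 (k : R) : (k * `|z : R|) @[z --> (0 : R)] --> (0 : R).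
    have ck : continuous (fun _ : R => k) by move=> z; exact: cvg_cst.
    have ckn : continuous (fun z : R => k * `|z|).
      exact: (continuousM_fun ck (@norm_continuous _ R)).
    have := ckn 0.
    by rewrite /continuous_at /= normr0 mulr0.
  apply: (squeeze_cvgr _ (lim0 (- K)) (lim0 K)).
  apply: nearW => z; rewrite mulNr -ler_norml.
  have [->|z0] := eqVneq z 0; first by rewrite invr0 mulr0 normr0 mulr0.
  rewrite normrM normfV ler_pdivrMr ?normr_gt0// -mulrA -expr2 real_normK//.
  exact: num_real.
- by rewrite invr0 mulr0.
Qed.

Lemma flat_der p x : has_der x (flat p) (flat ('X^2 * (p - p^`())) x).
Proof.
have [x0|x0|->] := ltgtP x 0; last first.
- rewrite flat_le0//; have [K [_ hK]] := flat_bound p.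
  exact: has_der0_quadratic hK.
- have : has_der x (fun y => p.[y^-1] * expR (- y^-1)) (flat ('X^2 * (p - p^`())) x).
    have dV : has_der x (fun y : R => y^-1) (- 1 / x ^+ 2).
      by apply: derV; [rewrite gt_eqF|exact: derId].
    apply: der_eq.
      apply: derM; last exact/der_expR/derN/dV.
      apply: (@der_comp _ (fun y => y^-1) (horner p)); last exact: dV.
      exact: is_derive_poly.
    rewrite /flat x0 !hornerE /=; field; rewrite gt_eqF//.
  rewrite /has_der; apply: near_eq_is_derive; near=> y.
  by rewrite /flat ifT//; near: y; exact: lt_nbhsr.
- rewrite flat_le0 ?ltW//.
  have := derC 0 x; rewrite /has_der; apply: near_eq_is_derive; near=> y.
  by rewrite flat_le0// ltW//; near: y; exact: lt_nbhsl.
Unshelve. all: by end_near. Qed.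

Lemma Ck_flat n p : Ck n (flat p).
Proof.
elim: n p => [//|n ih] p; apply: Ck_der (ih _).
by move=> x; exact: flat_der.
Qed.

Definition bump x : R := flat 1 x * flat 1 (1 - x).

Lemma Ck_bump n : Ck n bump.
Proof.
apply: CkM; first exact: Ck_flat.
rewrite (_ : (fun x => _) = (fun x => flat 1 (-1 * x + 1))).
  exact/Ck_affine/Ck_flat.
by apply/funext => x; rewrite mulN1r addrC.
Qed.

Lemma bump_gt0 x : 0 < x < 1 -> 0 < bump x.
Proof.
move=> /andP[x0 x1].
have flat_gt0 t : 0 < t -> 0 < flat 1 t.
  by move=> t0; rewrite /flat t0 !hornerE /= ?mul1r expR_gt0.
by rewrite /bump mulr_gt0// flat_gt0// subr_gt0.
Qed.

Lemma bump_eq0 x : ~~ (0 < x < 1) -> bump x = 0.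
Proof.
rewrite negb_and -!leNgt => /orP[x0|x1]; rewrite /bump.
  by rewrite flat_le0 ?mul0r.
by rewrite (@flat_le0 _ (1 - x)) ?mulr0// subr_le0.
Qed.

Lemma bump_ge0 x : 0 <= bump x.
Proof.
by have [/bump_gt0/ltW//|/bump_eq0->] := boolP (0 < x < 1).
Qed.

Lemma smooth_step : exists H : R -> R, [/\ forall n, Ck n H,
  forall x, has_der x H (bump x), forall x, x <= 0 -> H x = H 0 &
  forall x, 1 <= x -> H x = H 1].
Proof.
have cb : continuous bump.
  by have [db _] := CkS (Ck_bump 1); exact: ders_continuous db.
have [H hH] := antiderivative cb; exists H; split=> //.
- by case=> [//|n]; apply: Ck_der hH _; exact: Ck_bump.
- move=> x; rewrite le_eqVlt => /predU1P[->//|x0].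
  have [c [_ c0]] := der_mvt x0 hH; rewrite bump_eq0 ?mul0r; last first.
    by rewrite (ltNge 0) ltW.
  by move=> /subr0_eq.
- move=> x; rewrite le_eqVlt => /predU1P[->//|x1].
  have [c [c1 _]] := der_mvt x1 hH; rewrite bump_eq0 ?mul0r; last first.
    by rewrite negb_and -!leNgt (ltW c1) orbT.
  by move=> /subr0_eq.
Qed.

End SmoothFunctions.

(** * Weak derivatives *)

Section WeakDerivatives.
Variable R : realType.
Implicit Types (f g df F psi : R -> R) (x M : R).
Local Notation mu := (@lebesgue_measure R).

Lemma integral_compact_support f F M : 0 < M -> continuous f ->
  (forall x, has_der x F (f x)) -> (forall x, M < `|x| -> f x = 0) ->
  integral_R f = F M - F (- M).
Proof.
move=> M0 cf hF f0.
have fE : f = f \_ `[- M, M].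
  apply/funext => x; rewrite patchE; case: ifPn => //.
  rewrite notin_setE /= in_itv /= -ler_norml => /negP.
  by rewrite -ltNge => /f0.
have cF : continuous F by exact: ders_continuous hF.
rewrite /integral_R {1}fE -Rintegral_mkcond /Rintegral.
rewrite (@continuous_FTC2 _ f F)//.
- by lra.
- exact: continuous_subspaceT.
- split; first by move=> x _; exact: der_derivable (hF x).
  + exact/cvg_at_right_filter/cF.
  + exact/cvg_at_left_filter/cF.
- by move=> x _; exact: derE.
Qed.

Lemma test_fun_support psi : test_fun psi -> exists M, [/\ 0 < M,
  forall x, M <= `|x| -> psi x = 0 & forall x, M <= `|x| -> derive1 psi x = 0].
Proof.
(* The extra 1 leaves room for a unit ball on which [psi] vanishes, so that its derivative vanishes
   at the centre. *)
move=> [_ [M hM]]; exists (`|M| + 1).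
have MM x : `|M| + 1 <= `|x| -> M < `|x|.
  by have := ler_norm M; lra.
split=> [|x /MM/hM//|x xM]; first by have := normr_ge0 M; lra.
apply: derE; have := derC 0 x; rewrite /has_der.
apply: near_eq_is_derive; near=> y; apply/esym/hM.
have yx : `|x - y| < 1 by near: y; apply: cvgr_dist_lt => //; exact: cvg_id.
have := ler_normD y (x - y); rewrite addrC subrK.
by have := ler_norm M; lra.
Unshelve. all: by end_near. Qed.

Lemma smooth_der psi : smooth psi -> forall x, has_der x psi (derive1 psi x).
Proof. by move=> /smoothP/(_ 1%N)/CkS[]. Qed.

Lemma smooth_continuous_derive1 psi : smooth psi -> continuous (derive1 psi).
Proof.
move=> /smoothP/(_ 2%N)/CkS[_ /CkS[dpsi _]].
exact: ders_continuous dpsi.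
Qed.

Lemma smooth_continuous psi : smooth psi -> continuous psi.
Proof. by move=> /smooth_der; exact: ders_continuous. Qed.

(** Integration by parts at the level of primitives: [F1 + F2 - f * psi] has zero derivative, and
    [psi] vanishes at both ends. *)
Lemma weak_deriv_classical f df : (forall x, has_der x f (df x)) ->
  continuous df -> weak_deriv f df.
Proof.
move=> hf cdf psi tpsi; have spsi := tpsi.1.
have [M [M0 psi0 dpsi0]] := test_fun_support tpsi.
have cf : continuous f by exact: ders_continuous hf.
have c1 := continuousM_fun cf (smooth_continuous_derive1 spsi).
have c2 := continuousM_fun cdf (smooth_continuous spsi).
have [F1 hF1] := antiderivative c1.
have [F2 hF2] := antiderivative c2.
rewrite (integral_compact_support M0 c1 hF1); last first.
  by move=> x /ltW/dpsi0 ->; rewrite mulr0.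
rewrite (integral_compact_support M0 c2 hF2); last first.
  by move=> x /ltW/psi0 ->; rewrite mulr0.
have h x : has_der x (fun x => F1 x + F2 x - f x * psi x) 0.
  apply: der_eq.
    apply: derB; first exact: derD (hF1 x) (hF2 x).
    exact: derM (hf x) (smooth_der spsi x).
  by rewrite /=; ring.
have nM : `|M| = M by rewrite gtr0_norm.
by have := der_eq0_cst h M (- M); rewrite /= !psi0 ?normrN ?nM//; lra.
Qed.

(* Du Bois-Reymond: if [F a < k < F b], test against a function stepping up at
   [a] and down at [b], so that [(F - k) psi'] has constant sign. *)
Lemma dderiv_zero_cst F : continuous F -> dderiv_zero F ->
  forall a b, F a = F b.
Proof.
move=> cF F0.
suff lt_false a b : F a < F b -> False.
  by move=> a b; have [/lt_false|/lt_false|] := ltgtP (F a) (F b).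
move=> Fab; pose k := (F a + F b) / 2.
have near_lt (c e : R) : 0 < e ->
    exists2 d : R, 0 < d & forall x, `|x - c| < d -> `|F x - F c| < e.
  move=> e0; have /cvgr_distC_lt/(_ _ e0)/nbhs_ballP[d /= d0 hd] := cF c.
  by exists d => // x xc; apply: hd; rewrite /ball /= distrC.
pose eps := (F b - F a) / 2.
have eps0 : 0 < eps by rewrite /eps; lra.
have [d1 d10 h1] := near_lt a _ eps0.
have [d2 d20 h2] := near_lt b _ eps0.
pose e : R := Num.min d1 d2.
have e0 : 0 < e by rewrite lt_min d10 d20.
have [H [cH hH H0 H1]] := smooth_step R.
pose step (c x : R) : R := H (e^-1 * x + - (c / e)).
have hstep c x : has_der x (step c) (bump ((x - c) / e) / e).
  apply: der_eq.
    apply: (@der_comp _ (fun x => e^-1 * x + - (c / e)) H).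
      exact: hH.
    apply: derD; last exact: derC.
    by apply: derM; [exact: derC|exact: derId].
  rewrite /= mul0r add0r mulr1 addr0; congr (bump _ / _).
  by rewrite mulrBl [e^-1 * x]mulrC.
pose psi (x : R) : R := step a x - step b x.
have hpsi x : has_der x psi ((bump ((x - a) / e) - bump ((x - b) / e)) / e).
  by apply: der_eq (derB (hstep a x) (hstep b x)) _; rewrite -mulrBl.
have argE c x : e^-1 * x + - (c / e) = (x - c) / e by rewrite mulrBl [e^-1 * x]mulrC.
have tpsi : test_fun psi.
  split.
    apply/smoothP => n; apply: CkD; first exact/Ck_affine/cH.
    exact/CkN/Ck_affine/cH.
  exists (`|a| + `|b| + e) => x xM; rewrite /psi /step !argE.
  have an := ler_norm a; have bn := ler_norm b.
  have an' := ler_norm (- a); have bn' := ler_norm (- b).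
  rewrite normrN in an'; rewrite normrN in bn'.
  have [x0|x0] := leP 0 x.
    rewrite (ger0_norm x0) in xM.
    rewrite (H1 ((x - a) / e)) ?(H1 ((x - b) / e)) ?subrr// ler_pdivlMr// mul1r;
      by have := normr_ge0 a; have := normr_ge0 b; lra.
  rewrite (ltr0_norm x0) in xM.
  by rewrite (H0 ((x - a) / e)) ?(H0 ((x - b) / e)) ?subrr// ler_pdivrMr// mul0r;
      have := normr_ge0 a; have := normr_ge0 b; lra.
have [M [M0 psi0 dpsi0]] := test_fun_support tpsi.
have c1 := continuousM_fun cF (smooth_continuous_derive1 tpsi.1).
have [J hJ] := antiderivative c1.
have J0 : J M - J (- M) = 0.
  rewrite -(F0 _ tpsi) (integral_compact_support M0 c1 hJ)//.
  by move=> x /ltW/dpsi0 ->; rewrite mulr0.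
(* [K] has derivative (k - F) psi', which is nonnegative, and equal values at -M and M. It is thus
   constant in between, although its derivative is positive at [x0], the centre of the bump at
   [a]. *)
pose K (x : R) : R := k * psi x - J x.
pose dK (x : R) : R := (k - F x) * ((bump ((x - a) / e) - bump ((x - b) / e)) / e).
have hK x : has_der x K (dK x).
  apply: der_eq.
    apply: derB; last exact: hJ.
    by apply: derM; [exact: derC|exact: hpsi].
  by rewrite /= (derE (hpsi x)) /dK; ring.
have in_bump c x : 0 < (x - c) / e < 1 -> `|x - c| < e.
  rewrite ltr_pdivlMr// ltr_pdivrMr// mul0r mul1r => /andP[h3 h4].
  by rewrite gtr0_norm.
have na x : 0 < (x - a) / e < 1 -> 0 < k - F x.
  move=> /in_bump xa; have : `|x - a| < d1 by rewrite (lt_le_trans xa)// ge_min lexx.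
  by move=> /h1; rewrite ltr_norml /eps /k; lra.
have nb x : 0 < (x - b) / e < 1 -> k - F x < 0.
  move=> /in_bump xb; have : `|x - b| < d2 by rewrite (lt_le_trans xb)// ge_min lexx orbT.
  by move=> /h2; rewrite ltr_norml /eps /k; lra.
have dK1 x : 0 <= (k - F x) * bump ((x - a) / e).
  have [xa|/bump_eq0->] := boolP (0 < (x - a) / e < 1); last by rewrite mulr0.
  by rewrite mulr_ge0 ?bump_ge0// ltW// na.
have dK2 x : 0 <= (k - F x) * - bump ((x - b) / e).
  have [xb|/bump_eq0->] := boolP (0 < (x - b) / e < 1); last by rewrite oppr0 mulr0.
  by rewrite mulrN -mulNr mulr_ge0 ?bump_ge0// oppr_ge0 ltW// nb.
have dK0 x : 0 <= dK x.
  rewrite /dK mulrA mulrBr -mulrN; apply: divr_ge0; last exact: ltW.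
  exact: addr_ge0.
have K_nd := der_ge0_nondecreasing hK dK0.
have KM : K M = K (- M).
  have nM : `|M| = M by rewrite gtr0_norm.
  by rewrite /K !psi0 ?normrN ?nM//; lra.
pose x0 := a + e / 2.
have x0b : 0 < (x0 - a) / e < 1.
  have -> : (x0 - a) / e = 1 / 2 by rewrite /x0; field; rewrite gt_eqF.
  by lra.
have dKx0 : 0 < dK x0.
  rewrite /dK mulrA mulrBr -mulrN; apply: divr_gt0 => //.
  by apply: ltr_wpDr => //; apply: mulr_gt0; [exact: na|exact: bump_gt0].
have x0M : `|x0| < M.
  rewrite ltNge; apply/negP => /dpsi0; rewrite (derE (hpsi x0)) => h.
  by move: dKx0; rewrite /dK h mulr0 ltxx.
have Kx y : - M <= y <= M -> K y = K (- M).
  move=> /andP[y1 y2]; apply/eqP; rewrite eq_le -{1}KM !K_nd//.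
have : has_der x0 K 0.
  have := derC (K (- M)) x0; rewrite /has_der; apply: near_eq_is_derive.
  near=> y; apply/esym/Kx; rewrite -ler_norml ltW//; near: y.
  apply: (@cvgr_norm_lt _ _ _ _ _ id x0) => //; exact: cvg_id.
by move=> /derE; rewrite (derE (hK x0)) => h; move: dKx0; rewrite h ltxx.
Unshelve. all: by end_near. Qed.

End WeakDerivatives.

(** * Limits at infinity *)

Section Limits.
Variable R : realType.
Implicit Types (f g : R -> R) (x y l a b : R).

Definition limy f l : Prop := f x @[x --> +oo] --> l.

Lemma limyC a : limy (fun=> a) a.
Proof. exact: cvg_cst. Qed.

Lemma limyD f g a b : limy f a -> limy g b -> limy (fun x => f x + g x) (a + b).
Proof. by move=> fa gb; exact: (cvgD fa gb). Qed.

Lemma limyN f a : limy f a -> limy (fun x => - f x) (- a).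
Proof. by move=> fa; exact: (cvgN fa). Qed.

Lemma limyM f g a b : limy f a -> limy g b -> limy (fun x => f x * g x) (a * b).
Proof. by move=> fa gb; exact: (cvgM fa gb). Qed.

Lemma limyX f a n : limy f a -> limy (fun x => f x ^+ n) (a ^+ n).
Proof.
move=> fa; elim: n => [|n ih]; first exact: limyC.
rewrite exprS (_ : (fun _ => _) = (fun x => f x * f x ^+ n)); first exact: limyM.
by apply/funext => x; rewrite exprS.
Qed.

Lemma limyV f a : a != 0 -> limy f a -> limy (fun x => (f x)^-1) a^-1.
Proof. by move=> a0 fa; exact: (cvgV a0 fa). Qed.

Lemma limy_unique f a b : limy f a -> limy f b -> a = b.
Proof. by move=> fa fb; exact: (cvg_unique _ fa fb). Qed.

Lemma limyP f l : limy f l <->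
  forall e : R, 0 < e -> exists M, forall x, M < x -> `|f x - l| < e.
Proof.
split=> [fl e e0|h].
  have /cvgr_distC_lt/(_ _ e0)[M [_ hM]] := fl.
  by exists M => x /hM.
apply/cvgrPdistC_lt => e /h[M hM].
by exists M; split; [exact: num_real|move=> x /hM].
Qed.

Lemma vanishes_eps f : vanishes_at_infty f ->
  forall e : R, 0 < e -> exists2 M, 0 < M & forall x, M <= `|x| -> `|f x| < e.
Proof.
move=> [fy fNy] e e0.
have [M1 hM1] := (limyP _ _).1 fy e e0.
have fN : limy (fun x => f (- x)) 0 by move/cvgNy_compNP : fNy.
have [M2 hM2] := (limyP _ _).1 fN e e0.
have nM1 := ler_norm M1; have nM2 := ler_norm M2.
have M10 := normr_ge0 M1; have M20 := normr_ge0 M2.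
exists (`|M1| + `|M2| + 1) => [|x xM]; first by lra.
have [x0|x0] := leP 0 x.
  rewrite (ger0_norm x0) in xM; rewrite -(subr0 (f x)); apply: hM1; lra.
rewrite (ltr0_norm x0) in xM.
by rewrite -(subr0 (f x)) -(opprK x); apply: hM2; lra.
Qed.

Lemma vanishes_bounded f : continuous f -> vanishes_at_infty f ->
  exists2 C, 0 <= C & forall x, `|f x| <= C.
Proof.
move=> cf vf; have [M M0 hM] := vanishes_eps vf ltr01.
have MM : - M <= M by lra.
have cn : {within `[- M, M], continuous (fun x => `|f x|)}.
  apply: continuous_subspaceT => x.
  apply: (@continuous_comp _ _ _ f (@Num.norm _ R)); first exact: cf.
  exact: norm_continuous.
have [c _ hc] := EVT_max MM cn.
exists (`|f c| + 1) => [|x]; first by have := normr_ge0 (f c); lra.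
have [/hM|xM] := leP M `|x|; first by have := normr_ge0 (f c); lra.
have : x \in `[- M, M]%R by rewrite in_itv /= -ler_norml ltW.
by move=> /hc; lra.
Qed.

Lemma vanishes_min f x0 : continuous f -> vanishes_at_infty f -> f x0 < 0 ->
  exists y, forall x, f y <= f x.
Proof.
move=> cf vf fx0; have fx0' : 0 < - f x0 by lra.
have [M M0 hM] := vanishes_eps vf fx0'.
have MM : - M <= M by lra.
have [c _ hc] := EVT_min MM (continuous_subspaceT cf).
have in_itvM x : `|x| < M -> x \in `[- M, M]%R.
  by move=> xM; rewrite in_itv /= -ler_norml ltW.
have fc : f c <= f x0.
  apply/hc/in_itvM; rewrite ltNge; apply/negP => /hM.
  by rewrite ltr0_norm// ltxx.
exists c => x; have [/hM|/in_itvM/hc//] := leP M `|x|.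
by rewrite ltr_norml => /andP[h _]; lra.
Qed.

Lemma der_at_min f f1 y : (forall x, has_der x f (f1 x)) ->
  (forall x, f y <= f x) -> f1 y = 0.
Proof.
move=> hf hy.
have yy : y - 1 <= y + 1 by lra.
have /derE : has_der y f 0.
  apply: (derive1_at_min yy) => [t _||t _]; last exact: hy.
    exact: der_derivable (hf t).
  by rewrite in_itv /=; lra.
by rewrite (derE (hf y)).
Qed.

Lemma ivt f a b v : a <= b -> continuous f -> f a <= v -> v <= f b ->
  exists c, f c = v.
Proof.
move=> ab cf av vb.
have [|c _ fc] := @IVT _ f a b v ab (continuous_subspaceT cf); last by exists c.
by rewrite ge_min av le_max vb orbT.
Qed.

(** A second difference with unit step equals f'' at an intermediate point and tends to 0 with f, so
    l = 0. Then f' differs from a unit first difference of f by at most a value of f'', and both are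
    small. *)
Lemma limy_second_derivative f f1 f2 l : (forall x, has_der x f (f1 x)) ->
  (forall x, has_der x f1 (f2 x)) -> limy f 0 -> limy f2 l ->
  l = 0 /\ limy f1 0.
Proof.
move=> hf hf1 /limyP f0 /limyP f2l.
have l0 : l = 0.
  apply/eqP/negPn/negP => lN0.
  have n0 : 0 < `|l| by rewrite normr_gt0.
  have [M1 hM1] := f0 (`|l| / 8) ltac:(lra).
  have [M2 hM2] := f2l (`|l| / 2) ltac:(lra).
  pose x := `|M1| + `|M2| + 1.
  have nM1 := ler_norm M1; have nM2 := ler_norm M2.
  have M10 := normr_ge0 M1; have M20 := normr_ge0 M2.
  pose g t := f (t + 1) - f t.
  have hsh (h h1 : R -> R) t : (forall x, has_der x h (h1 x)) ->
      has_der t (fun t => h (t + 1)) (h1 (t + 1)).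
    move=> hh; apply: der_eq.
      apply: (@der_comp _ (fun t => t + 1)); first exact: hh.
      by apply: derD; [exact: derId|exact: derC].
    by rewrite addr0 mulr1.
  have hg t : has_der t g (f1 (t + 1) - f1 t).
    by apply: derB; [exact: hsh|exact: hf].
  have [xi [xxi _ e1]] : exists c, [/\ x < c, c < x + 1 &
      g (x + 1) - g x = (f1 (c + 1) - f1 c) * (x + 1 - x)].
    by apply: (der_mvt _ hg); lra.
  have [z [xiz _ e2]] : exists c, [/\ xi < c, c < xi + 1 &
      f1 (xi + 1) - f1 xi = f2 c * (xi + 1 - xi)].
    by apply: (der_mvt _ hf1); lra.
  have {e2} e2 : f2 z = f (x + 1 + 1) - f (x + 1) - (f (x + 1) - f x).
    by move: e1; rewrite /g e2; lra.
  have := hM1 (x + 1 + 1) ltac:(rewrite /x; lra).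
  have := hM1 (x + 1) ltac:(rewrite /x; lra).
  have := hM1 x ltac:(rewrite /x; lra).
  have := hM2 z ltac:(rewrite /x in xxi; lra).
  rewrite !subr0 e2 !ltr_norml => /andP[a1 a2] /andP[b1 b2] /andP[c1 c2] /andP[d1 d2].
  have [l_ge0|l_lt0] := leP 0 l.
    by rewrite (ger0_norm l_ge0) in n0 a1 a2 b1 b2 c1 c2 d1 d2 *; lra.
  by rewrite (ltr0_norm l_lt0) in n0 a1 a2 b1 b2 c1 c2 d1 d2 *; lra.
split=> //; apply/limyP => e e0; rewrite {}l0 in f2l.
have [M1 hM1] := f0 (e / 4) ltac:(lra).
have [M2 hM2] := f2l (e / 2) ltac:(lra).
exists (`|M1| + `|M2|) => x xM; rewrite subr0.
have nM1 := ler_norm M1; have nM2 := ler_norm M2.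
have M10 := normr_ge0 M1; have M20 := normr_ge0 M2.
have [xi [xxi xi1 e1]] : exists c, [/\ x < c, c < x + 1 &
    f (x + 1) - f x = f1 c * (x + 1 - x)].
  by apply: (der_mvt _ hf); lra.
have [z [xz zxi e2]] := der_mvt xxi hf1.
have := hM1 (x + 1) ltac:(lra).
have := hM1 x ltac:(lra).
have := hM2 z ltac:(lra).
rewrite !subr0 !ltr_norml => /andP[a1 a2] /andP[b1 b2] /andP[c1 c2].
have k1 : - (e / 2) <= f2 z * (xi - x) <= e / 2 by apply/andP; split; nra.
by rewrite -e2 in k1; lra.
Qed.

End Limits.

(** * Wave profiles *)

Section Profiles.
Variable R : realType.
Implicit Types (phi eta p q : R -> R) (A c x : R).

(** This is phi'' as a function of phi. The term c^2 (c - z)^-2 is (1 + eta)^2, because 1 + phi / (c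
    - phi) = c / (c - phi), and the final 1/2 is the integration constant. *)
Definition profile_rhs A c (z : R) : R :=
  ((c + A) * z - 3 / 2 * z ^+ 2 - 1 / 2 * c ^+ 2 * ((c - z)^-1) ^+ 2 + 1 / 2) / c.

(* The travelling-wave equation for [phi] once [eta] is eliminated through
   [eta (c - phi) = phi]. *)
Record profile A c p q : Prop := Profile {
  profile_der : forall x, has_der x p (q x);
  profile_der2 : forall x, has_der x q (profile_rhs A c (p x));
  profile_lt : forall x, 0 < c * (c - p x);
  profile_vanishes : vanishes_at_infty p;
  profile_der_lim : limy q 0 }.

Lemma profile_sub_neq0 A c p q x : profile A c p q -> c - p x != 0.
Proof.
move=> pq; apply/eqP => h; have := profile_lt pq x.
by rewrite h mulr0 ltxx.
Qed.

Lemma profile_smooth A c p q : profile A c p q -> smooth p.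
Proof.
(* The equation raises the order by two, hence an induction on a bound for the order. *)
move=> pq; apply/smoothP => n; elim: n {-2}n (leqnn n) => [|n ih] [|[|k]]//.
  move=> _; apply: (@Ck_der _ _ _ q) => //; exact: profile_der pq.
move=> kn; have {}ih : Ck k p by apply: ih; rewrite -ltnS ltnW.
apply: Ck_der (profile_der pq) _; apply: Ck_der (profile_der2 pq) _.
rewrite /profile_rhs; apply: CkM; last exact: Ck_cst.
apply: CkD; last exact: Ck_cst.
apply: CkD.
  apply: CkD; first by apply: CkM => //; exact: Ck_cst.
  by apply/CkN/CkM; [exact: Ck_cst|exact: CkX].
apply/CkN/CkM; first exact: Ck_cst.
apply/CkX/CkV => [x|]; first exact: profile_sub_neq0 pq.
by apply: CkD; [exact: Ck_cst|exact: CkN].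
Qed.

Lemma smooth_ratio c p : (forall x, c - p x != 0) -> smooth p ->
  smooth (fun x => p x / (c - p x)).
Proof.
move=> cp /smoothP sp; apply/smoothP => n; apply: CkM => //.
by apply: CkV => //; apply: CkD; [exact: Ck_cst|exact: CkN].
Qed.

Lemma vanishesN p : vanishes_at_infty p -> vanishes_at_infty (fun x => - p x).
Proof.
by move=> [p1 p2]; split; rewrite -oppr0; [exact: (cvgN p1)|exact: (cvgN p2)].
Qed.

Lemma profileN A c p q : profile A c p q ->
  profile (- A) (- c) (fun x => - p x) (fun x => - q x).
Proof.
move=> pq; split.
- by move=> x; exact/derN/(profile_der pq).
- move=> x; apply: der_eq (derN (profile_der2 pq x)) _.
  rewrite /profile_rhs.
  have -> : (- c - - p x)^-1 = - (c - p x)^-1.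
    by rewrite -invrN; congr (_^-1); ring.
  by rewrite invrN; ring.
- by move=> x; rewrite -opprD mulrNN; exact: profile_lt pq x.
- exact/vanishesN/(profile_vanishes pq).
- by rewrite -oppr0; exact/limyN/(profile_der_lim pq).
Qed.

(** Multiplying the equation by 2 c q and integrating gives a constant [E]; it is 0 because [p] and
    [q] both tend to 0 at +oo. *)
Lemma profile_energy A c p q : profile A c p q ->
  forall x, c * q x ^+ 2 = p x ^+ 2 * (c + A - p x - (c - p x)^-1).
Proof.
move=> pq x.
have c0 : c != 0.
  by apply/eqP => h; have := profile_lt pq x; rewrite h mul0r ltxx.
pose E x := c * q x ^+ 2 - p x ^+ 2 * (c + A - p x - (c - p x)^-1).
have hE y : has_der y E 0.
  have cp := profile_sub_neq0 y pq.
  have h1 := derM (derC c y) (derX 2 (profile_der2 pq y)).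
  have h2 := derX 2 (profile_der pq y).
  have h3 : has_der y (fun x => c - p x) (0 - q y).
    by apply: derB; [exact: derC|exact: profile_der pq y].
  have h4 := derB (derB (derC (c + A) y) (profile_der pq y)) 
    (@derV _ (fun x => c - p x) _ _ cp h3).
  apply: der_eq (derB h1 (derM h2 h4)) _.
  by rewrite /profile_rhs /=; field; rewrite c0 cp.
have Elim : limy E (c * 0 ^+ 2 + - (0 ^+ 2 * (c + A + - 0 + - (c + - 0)^-1))).
  have p0 := (profile_vanishes pq).1.
  have cp0 : limy (fun x => c - p x) (c + - 0).
    by apply: limyD; [exact: limyC|exact: limyN].
  apply: limyD.
    by apply: limyM; [exact: limyC|exact/limyX/(profile_der_lim pq)].
  apply/limyN/limyM; first exact: limyX.
  apply: limyD; first by apply: limyD; [exact: limyC|exact: limyN].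
  by apply/limyN/limyV => //; rewrite subr0.
have Ex : E = (fun=> E x) by apply/funext => y; exact: (der_eq0_cst hE).
have : E x = 0.
  rewrite Ex in Elim; rewrite (limy_unique (@limyC _ (E x)) Elim).
  by rewrite expr0n /= mulr0 mul0r subr0.
by rewrite /E => /subr0_eq.
Qed.

(** By Young's inequality w = p^2 satisfies |w'| <= (k + 1) w. Hence e^((k+1)x) w is nondecreasing,
    which settles x <= x0, and e^(-(k+1)x) w is nonincreasing, which settles x >= x0. *)
Lemma gronwall_eq0 p q (k : R) x0 : (forall x, has_der x p (q x)) ->
  (forall x, q x ^+ 2 <= k * p x ^+ 2) -> p x0 = 0 -> forall x, p x = 0.
Proof.
move=> hp hk px0 x.
pose w x := p x ^+ 2.
have hw y : has_der y w (2 * p y * q y).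
  by apply: der_eq (derX 2 (hp y)) _; rewrite /= expr1.
have hexp (m : R) y : has_der y (fun x => expR (m * x) * w x)
    (expR (m * y) * (m * w y + 2 * p y * q y)).
  have hm : has_der y (fun x => m * x) m.
    by apply: der_eq (derM (derC m y) (derId y)) _; rewrite /=; ring.
  by apply: der_eq (derM (der_expR hm) (hw y)) _; rewrite /=; ring.
have young y : `|2 * p y * q y| <= (k + 1) * w y.
  rewrite /w ler_norml; have h := hk y.
  have := sqr_ge0 (p y - q y); have := sqr_ge0 (p y + q y).
  by rewrite sqrrD sqrrB => h1 h2; apply/andP; split; lra.
suff : w x <= 0.
  by rewrite /w => h; apply/eqP; rewrite -sqrf_eq0 eq_le h sqr_ge0.
have w0 : w x0 = 0 by rewrite /w px0 expr0n.
have [xx0|/ltW xx0] := leP x x0.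
  have := der_ge0_nondecreasing (hexp (k + 1)) _ xx0.
  rewrite w0 mulr0 pmulr_rle0 ?expR_gt0//; apply=> y.
  rewrite mulr_ge0 ?expR_ge0//; have := young y; rewrite ler_norml; lra.
have hN y : has_der y (fun x => - (expR (- (k + 1) * x) * w x))
   (expR (- (k + 1) * y) * ((k + 1) * w y - 2 * p y * q y)).
  by apply: der_eq (derN (hexp (- (k + 1)) y)) _; ring.
have := der_ge0_nondecreasing hN _ xx0.
rewrite w0 mulr0 oppr0 oppr_ge0 pmulr_rle0 ?expR_gt0//; apply=> y.
rewrite mulr_ge0 ?expR_ge0//; have := young y; rewrite ler_norml; lra.
Qed.

Lemma profile_neq0 A c p q x0 : 0 < c -> profile A c p q -> p x0 != 0 ->
  forall x, p x != 0.
Proof.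
move=> c0 pq px0 x; apply/eqP => px; move/eqP: px0; apply.
have cp : continuous p by exact: ders_continuous (profile_der pq).
have [C C0 hC] := vanishes_bounded cp (profile_vanishes pq).
(* The constant bounds the bracket of the first integral divided by [c]: the term - (c - p)^-1 is
   negative and |p| <= C. *)
apply: (@gronwall_eq0 p q ((c + `|A| + C) / c) x) => //; first exact: profile_der pq.
move=> y; rewrite -(ler_pM2l c0) (profile_energy pq).
have -> : c * ((c + `|A| + C) / c * p y ^+ 2) = p y ^+ 2 * (c + `|A| + C).
  by field; rewrite gt_eqF.
rewrite ler_wpM2l ?sqr_ge0//.
have : 0 < (c - p y)^-1 by rewrite invr_gt0 -(pmulr_rgt0 _ c0) (profile_lt pq).
have := hC y; rewrite ler_norml => /andP[h1 h2]; have := ler_norm A.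
by lra.
Qed.

Lemma sqrt_disc_gt A : `|A| < Num.sqrt (A ^+ 2 + 4).
Proof.
rewrite -sqrtr_sqr ltr_sqrt; first by rewrite ltrDl.
by rewrite ltr_wpDl// sqr_ge0.
Qed.

Lemma sqr_sqrt_disc A : Num.sqrt (A ^+ 2 + 4) ^+ 2 = A ^+ 2 + 4.
Proof. by rewrite sqr_sqrtr// addr_ge0// sqr_ge0. Qed.

(* [c - A1] is the only admissible critical value of [phi], so [c <= A1] would
   make the negative minimum of [phi] an upper bound as well. *)
Lemma profile_speed A c p q x0 : 0 < c -> profile A c p q -> p x0 != 0 ->
  (- A + Num.sqrt (A ^+ 2 + 4)) / 2 < c.
Proof.
move=> c0 pq px0.
have pN0 := profile_neq0 c0 pq px0.
have := sqrt_disc_gt A; have := sqr_sqrt_disc A.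
set s : R := Num.sqrt _ => s2; rewrite ltr_norml => /andP[sA1 sA2].
pose A1 : R := (- A + s) / 2; pose A2 : R := (- A - s) / 2.
rewrite -/A1.
(* Clearing the denominator turns the bracket of [profile_energy] into s^2 + A s - 1 at s = c - p x,
   with roots [A1] and [A2]. *)
have energyE x : c * q x ^+ 2 * (c - p x) =
    p x ^+ 2 * ((c - p x - A1) * (c - p x - A2)).
  rewrite (profile_energy pq).
  have -> : (c - p x - A1) * (c - p x - A2) = (c - p x) ^+ 2 + A * (c - p x) - 1.
    have -> : 1 = (s ^+ 2 - A ^+ 2) / 4 by rewrite s2; field.
    by rewrite /A1 /A2; field.
  by have cp := profile_sub_neq0 x pq; field.
have cp0 x : 0 < c - p x by rewrite -(pmulr_rgt0 _ c0) (profile_lt pq).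
have p2 x : 0 < p x ^+ 2 by rewrite exprn_even_gt0//= pN0.
have A20 : A2 < 0 by rewrite /A2; lra.
have ple x : p x <= c - A1.
  have : 0 <= p x ^+ 2 * ((c - p x - A1) * (c - p x - A2)).
    rewrite -energyE; apply: mulr_ge0; last exact/ltW/cp0.
    by rewrite mulr_ge0 ?sqr_ge0// ltW.
  rewrite pmulr_rge0// pmulr_lge0; first by lra.
  by have := cp0 x; lra.
rewrite ltNge; apply/negP => cA1.
have pneg x : p x < 0.
  by rewrite lt_neqAle pN0 (le_trans (ple x))// subr_le0.
have cp : continuous p by exact: ders_continuous (profile_der pq).
have [y hy] := vanishes_min cp (profile_vanishes pq) (pneg x0).
have qy : q y = 0 by exact: der_at_min (profile_der pq) hy.
have : p y ^+ 2 * ((c - p y - A1) * (c - p y - A2)) = 0.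
  by rewrite -energyE qy expr0n /= mulr0 mul0r.
move=> /eqP; rewrite mulf_eq0 (gt_eqF (p2 y)) /= mulf_eq0.
rewrite [X in _ || X]gt_eqF ?orbF; last by have := cp0 y; lra.
move=> /eqP py.
have npy : 0 < - p y by have := pneg y; lra.
have [M _ hM] := vanishes_eps (profile_vanishes pq) npy.
have := hM M (ler_norm M); rewrite (ltr0_norm (pneg M)).
by have := ple M; lra.
Qed.

End Profiles.

(** * From solitary waves to profiles *)

Section WavesToProfiles.
Variable R : realType.
Implicit Types (phi eta : R -> R) (A c x : R).

Definition wave_source A phi eta (y : R) : R :=
  - A * phi y + 3 / 2 * (phi y) ^+ 2 + 1 / 2 * (1 + eta y) ^+ 2.

Lemma continuous_wave_source A phi eta : continuous phi -> continuous eta ->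
  continuous (wave_source A phi eta).
Proof.
move=> cphi ceta.
have cst (a : R) : continuous (fun _ : R => a) by move=> x; exact: cvg_cst.
have sqr (f : R -> R) : continuous f -> continuous (fun x => f x ^+ 2).
  by move=> cf; exact: (continuousM_fun cf cf).
apply: continuousD_fun; last first.
  by apply: continuousM_fun => //; apply/sqr/continuousD_fun.
by apply: continuousD_fun; apply: continuousM_fun => //; exact: sqr.
Qed.

Lemma wave_source_bounded A phi eta (C : R) : 0 <= C ->
  (forall x, `|phi x| <= C) -> (forall x, `|eta x| <= C) ->
  forall y, `|wave_source A phi eta y| <=
    `|A| * C + 3 / 2 * C ^+ 2 + 1 / 2 * (1 + C) ^+ 2.
Proof.
move=> C0 hphi heta y; rewrite /wave_source.
apply: (le_trans (ler_normD _ _)); apply: lerD.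
  apply: (le_trans (ler_normD _ _)); apply: lerD.
    by rewrite normrM normrN ler_wpM2l.
  rewrite normrM (ger0_norm (_ : 0 <= 3 / 2)) ?ler_wpM2l// ?normrX; [|lra..].
  by rewrite lerXn2r ?nnegrE.
rewrite normrM (ger0_norm (_ : 0 <= 1 / 2)) ?ler_wpM2l// ?normrX; [|lra..].
rewrite lerXn2r ?nnegrE ?addr_ge0//.
by rewrite (le_trans (ler_normD _ _))// normr1 lerD2l.
Qed.

Lemma limy_wave_source A phi eta : limy phi 0 -> limy eta 0 ->
  limy (wave_source A phi eta) (1 / 2).
Proof.
move=> lphi leta.
have : limy (wave_source A phi eta)
    (- A * 0 + 3 / 2 * 0 ^+ 2 + 1 / 2 * (1 + 0) ^+ 2).
  apply: limyD; last first.
    apply: limyM; first exact: limyC.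
    by apply/limyX/limyD => //; exact: limyC.
  apply: limyD; apply: limyM => //; [exact: limyC|exact: limyC|exact: limyX].
by rewrite expr0n /= !mulr0 !add0r addr0 expr1n mulr1.
Qed.

Lemma continuous_avoid_cst (f : R -> R) (v l : R) : continuous f -> limy f l ->
  (forall x, f x != v) -> v < l -> forall x, v < f x.
Proof.
move=> cf /limyP fl fv vl x; rewrite ltNge; apply/negP => fxv.
have [M hM] := fl (l - v) ltac:(lra).
pose y : R := `|M| + `|x| + 1.
have h1 := ler_norm M; have h2 := ler_norm x.
have h3 := normr_ge0 M; have h4 := normr_ge0 x.
have := hM y ltac:(rewrite /y; lra); rewrite ltr_norml => /andP[h5 _].
have xy : x <= y by rewrite /y; lra.
have vfy : v <= f y by lra.
have [z fz] := ivt xy cf fxv vfy.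
by have := fv z; rewrite fz eqxx.
Qed.

(** Each equation integrates to a constant. The second constant is 0 by decay of phi and eta; [K] is
    left free here, since the limit of the convolution at infinity is not computed. *)
Lemma wave_equations A c phi eta : solitary_wave A c phi eta ->
  exists (v1 : R -> R) (K : R), let v x := c * phi x + K in
  [/\ forall x, has_der x v (v1 x),
      forall x, has_der x v1 (v x - wave_source A phi eta x) &
      forall x, - c * eta x + (1 + eta x) * phi x = 0].
Proof.
move=> [[cphi _] [[ceta _] [_ [vphi [veta [eq1 eq2]]]]]].
have [C1 C10 hC1] := vanishes_bounded cphi vphi.
have [C2 C20 hC2] := vanishes_bounded ceta veta.
have cg := continuous_wave_source (A := A) cphi ceta.
have [] := conv_pker_derivatives cg
  (wave_source_bounded A (addr_ge0 C10 C20)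
    (fun x => le_trans (hC1 x) (ler_wpDr C20 (lexx _)))
    (fun x => le_trans (hC2 x) (ler_wpDl C10 (lexx _)))).
set v := Defs.conv _ _ => v1 [hv hv1].
have cst (a : R) : continuous (fun _ : R => a) by move=> x; exact: cvg_cst.
have cF : continuous (fun x => - c * phi x + v x).
  apply: continuousD_fun; last exact: ders_continuous hv.
  exact: continuousM_fun.
have cG : continuous (fun x => - c * eta x + (1 + eta x) * phi x).
  apply: continuousD_fun; first exact: continuousM_fun.
  by apply: continuousM_fun => //; exact: continuousD_fun.
have vE : v = (fun x => c * phi x + v 0 - c * phi 0).
  apply/funext => x; have := dderiv_zero_cst cF eq1 x 0; rewrite /=.
  by move=> h; lra.
exists v1, (v 0 - c * phi 0) => v'.
have v'E : v' = v by apply/funext => x; rewrite vE /v' addrA.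
rewrite v'E; split=> // x.
have e2 := dderiv_zero_cst cG eq2.
have : limy (fun x => - c * eta x + (1 + eta x) * phi x)
    (- c * 0 + (1 + 0) * 0).
  apply: limyD; first by apply: limyM; [exact: limyC|exact: veta.1].
  apply: limyM; last exact: vphi.1.
  by apply: limyD; [exact: limyC|exact: veta.1].
rewrite !mulr0 addr0 (_ : (fun _ => _) =
    (fun=> - c * eta x + (1 + eta x) * phi x)); last by apply/funext => y; exact: e2.
by move=> /(limy_unique (@limyC _ _)).
Qed.

Lemma wave_speed_neq0 A c phi eta : solitary_wave A c phi eta -> c != 0.
Proof.
move=> sw; apply/eqP => c0.
have [v1 [K []]] := wave_equations sw.
move: sw => [[cphi _] [[ceta _] [[x0 nz] [vphi [veta _]]]]].
rewrite c0 => hv hv1 e2.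
have v10 x : v1 x = 0.
  have h : has_der x (fun x => 0 * phi x + K) 0.
    by rewrite (_ : (fun _ => _) = fun=> K); [exact: derC|apply/funext => y; rewrite mul0r add0r].
  by rewrite -(derE (hv x)) (derE h).
have gK x : wave_source A phi eta x = K.
  have h : has_der x v1 0.
    by rewrite (_ : v1 = fun=> 0); [exact: derC|apply/funext].
  have := derE (hv1 x); rewrite (derE h) mul0r add0r => /esym/subr0_eq ->//.
have K12 : K = 1 / 2.
  have := @limy_wave_source A _ _ vphi.1 veta.1.
  rewrite (_ : wave_source _ _ _ = fun=> K); last exact/funext.
  by move=> /(limy_unique (@limyC _ _)).
(* Pointwise, either eta = -1, or phi = 0 and then (1 + eta)^2 = 1, so eta is 0 or -2. The value
   -1/2 separates 0 from the other two, and continuity with decay keeps eta on the side of 0. *)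
have eta_vals x : eta x != - (1 / 2).
  apply/eqP => h; have := e2 x; have := gK x; rewrite /wave_source K12 h.
  by rewrite oppr0 mul0r add0r => h1 h2; have : phi x = 0; [lra|move=> p0; move: h1; rewrite p0; lra].
have eta_gt x : - (1 / 2) < eta x.
  by apply: continuous_avoid_cst veta.1 eta_vals _ x => //; lra.
have phi0 x : phi x = 0.
  have /eqP := e2 x; rewrite oppr0 mul0r add0r mulf_eq0 => /orP[/eqP h|/eqP//].
  by have := eta_gt x; lra.
have eta0 x : eta x = 0.
  have := gK x; rewrite /wave_source K12 phi0 => h.
  have : eta x * (2 + eta x) = 0 by rewrite expr2 in h; lra.
  move=> /eqP; rewrite mulf_eq0 => /orP[/eqP//|/eqP h'].
  by have := eta_gt x; lra.
by case: nz; rewrite ?phi0 ?eta0 eqxx.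
Qed.

Lemma wave_profile A c phi eta : solitary_wave A c phi eta ->
  [/\ exists q, profile A c phi q,
      eta = (fun x => phi x / (c - phi x)) & exists x, phi x != 0].
Proof.
move=> sw; have c0 := wave_speed_neq0 sw.
have [v1 [K [hv hv1 e2]]] := wave_equations sw.
move: sw => [[cphi _] [[ceta _] [[x0 nz] [vphi [veta _]]]]].
have cst (a : R) : continuous (fun _ : R => a) by move=> x; exact: cvg_cst.
have lphi := vphi.1.
(* At a point where phi = c the second equation collapses to c = 0. *)
have cphiN0 x : c - phi x != 0.
  apply/eqP => h; have := e2 x; have -> : phi x = c by lra.
  by move=> h'; move/eqP: c0; apply; lra.
have etaE x : eta x = phi x / (c - phi x).
  apply: (mulIf (cphiN0 x)); rewrite divfK//.
  by have := e2 x; lra.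
have clt x : 0 < c * (c - phi x).
  apply: (@continuous_avoid_cst (fun x => c * (c - phi x)) 0 (c * (c + - 0))).
  - apply: continuousM_fun => //; apply: continuousD_fun => // y.
    exact: (continuousN (cphi y)).
  - apply: limyM; first exact: limyC.
    by apply: limyD; [exact: limyC|exact: limyN].
  - by move=> y; rewrite mulf_neq0.
  - by rewrite subr0 -expr2 exprn_even_gt0.
pose q x := v1 x / c.
have hq x : has_der x phi (q x).
  have := derM (derB (hv x) (derC K x)) (derC c^-1 x).
  rewrite (_ : (fun _ => _) = phi) => [h|]; last first.
    by apply/funext => y; rewrite addrK mulrAC mulfV// mul1r.
  by apply: der_eq h _; rewrite subr0 mulr0 addr0.
have hq1 x : has_der x q (phi x + (K - wave_source A phi eta x) / c).
  apply: der_eq (derM (hv1 x) (derC c^-1 x)) _.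
  by rewrite mulr0 addr0; field.
(* This limit of phi'' must be 0, which gives K = 1/2 and the decay of [q] at once. *)
have lim2 : limy (fun x => phi x + (K - wave_source A phi eta x) / c)
    (0 + (K - 1 / 2) / c).
  apply: limyD => //; apply: limyM; last exact: limyC.
  apply: limyD; first exact: limyC.
  by apply/limyN/limy_wave_source => //; exact: veta.1.
have [/eqP] := limy_second_derivative hq hq1 lphi lim2.
rewrite add0r mulf_eq0 invr_eq0 (negbTE c0) orbF subr_eq0 => /eqP K12 lq.
split; last 1 first.
- case: nz => [nz|]; first by exists x0.
  by rewrite etaE => nz; exists x0; apply: contra_neq nz => ->; rewrite mul0r.
- exists q; split=> // x; apply: der_eq (hq1 x) _.
  rewrite K12 /wave_source /profile_rhs etaE.
  by have cp := cphiN0 x; field; rewrite cp c0.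
- exact/funext.
Qed.

Lemma wave_smooth A c phi eta : solitary_wave A c phi eta ->
  smooth phi /\ smooth eta.
Proof.
move=> /wave_profile[[q pq] -> _]; have sphi := profile_smooth pq.
split=> //; apply: smooth_ratio => // x.
exact: profile_sub_neq0 pq.
Qed.

Lemma wave_speed A c phi eta : solitary_wave A c phi eta ->
  (- A + Num.sqrt (A ^+ 2 + 4)) / 2 < c \/
  c < (- A - Num.sqrt (A ^+ 2 + 4)) / 2.
Proof.
move=> sw; have c0 := wave_speed_neq0 sw.
have [[q pq] _ [x px]] := wave_profile sw.
have [c_lt0|c_gt0|/eqP] := ltgtP c 0; last by rewrite (negbTE c0).
  right; have Nc : 0 < - c by lra.
  have := @profile_speed _ _ _ _ _ x Nc (profileN pq).
  by rewrite oppr_eq0 sqrrN => /(_ px); lra.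
by left; exact: profile_speed c_gt0 pq px.
Qed.

End WavesToProfiles.

(** * From profiles to solitary waves *)

Section SquareIntegrable.
Variable R : realType.
Implicit Types (f g p q F : R -> R) (A c x : R).
Local Notation mu := (@lebesgue_measure R).

(** A bounded primitive of a nonnegative function is monotone, hence converges, and its increment
    bounds the integral on a half-line; reflection gives the other half. *)
Lemma ge0_integrable_bounded_primitive F f (C : R) : continuous f ->
  (forall x, 0 <= f x) -> (forall x, has_der x F (f x)) ->
  (forall x, `|F x| <= C) -> mu.-integrable [set: R] (EFin \o f).
Proof.
move=> cf f0 hF FC.
have half (g G : R -> R) : continuous g -> (forall x, 0 <= g x) ->
    (forall x, has_der x G (g x)) -> (forall x, `|G x| <= C) ->
    (\int[mu]_(x in `[0%R, +oo[) (g x)%:E < +oo)%E.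
  move=> cg g0 hG GC.
  have cG : continuous G by exact: ders_continuous hG.
  have lG : G x @[x --> +oo] --> sup (range G).
    apply: nondecreasing_cvgr; first exact: der_ge0_nondecreasing hG g0.
    by exists C => _ [y _ <-]; rewrite (le_trans (ler_norm _)).
  rewrite (@ge0_continuous_FTC2y _ g G 0 (sup (range G)))//.
  - by rewrite -EFinB ltry.
  - exact: continuous_subspaceT.
  - by move=> y _; exact: der_derivable (hG y).
  - exact/cvg_at_right_filter/cG.
  - by move=> y _; exact: derE.
have mf : measurable_fun [set: R] f by exact: continuous_measurable_fun.
apply/integrableP; split; first exact/measurable_EFinP.
rewrite (_ : (\int[mu]_(x in _) _)%E = (\int[mu]_(x in [set: R]) (f x)%:E)%E).
  rewrite -(itv_setU_setT false (0 : R)) ge0_integral_setU//=; last 3 first.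
  - by rewrite itv_setU_setT; exact/measurable_EFinP.
  - by move=> y _; rewrite lee_fin.
  - apply/disj_setPS => y /= []; rewrite !in_itv /= andbT => yx xy.
    by have := lt_le_trans xy yx; rewrite ltxx.
  rewrite integral_itv_obnd_cbnd; last exact/measurable_EFinP/measurable_funTS.
  apply: lte_add_pinfty; last exact: half hF FC.
  rewrite -[X in `]-oo, X]]oppr0 ge0_integration_by_substitutionNy//.
    apply: (half (fun x => f (- x)) (fun x => - F (- x))) => //.
    + exact: continuous_oppr.
    + by move=> x; apply: der_eq (derN (der_oppr (hF (- x)))) _; rewrite opprK.
    + by move=> x; rewrite normrN.
  exact: continuous_subspaceT.
by apply: eq_integral => x _ /=; rewrite ger0_norm.
Qed.

Lemma L2_le f g (C : R) : L2 f -> continuous g ->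
  (forall x, `|g x| <= C * `|f x|) -> L2 g.
Proof.
move=> [intf mf] cg gf; have mg := continuous_measurable_fun cg.
split=> //.
have := integrableZl (@measurableT _ _) (C ^+ 2) intf.
apply: le_integrable => //.
  by apply/measurable_EFinP; exact: measurable_funX.
move=> x _; rewrite -EFinM !abse_EFin lee_fin !ger0_norm ?sqr_ge0//; last first.
  by rewrite mulr_ge0 ?sqr_ge0.
rewrite -[g x ^+ 2]real_normK ?num_real// -[f x ^+ 2]real_normK ?num_real//.
by rewrite -exprMn lerXn2r ?nnegrE ?gf// (le_trans _ (gf x)).
Qed.

Lemma eps_vanishes f : (forall e : R, 0 < e ->
  exists M, forall x, M < `|x| -> `|f x| < e) -> vanishes_at_infty f.
Proof.
move=> h; split.
  apply/limyP => e /h[M hM]; exists M => x Mx.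
  by rewrite subr0; apply: hM; rewrite (lt_le_trans Mx)// ler_norm.
apply/cvgNy_compNP/limyP => e /h[M hM]; exists M => x Mx /=.
by rewrite subr0; apply: hM; rewrite normrN (lt_le_trans Mx)// ler_norm.
Qed.

Lemma vanishes_le f g (C : R) : vanishes_at_infty f -> 0 < C ->
  (forall x, `|g x| <= C * `|f x|) -> vanishes_at_infty g.
Proof.
move=> vf C0 gf; apply: eps_vanishes => e e0.
have [M _ hM] := vanishes_eps vf (divr_gt0 e0 C0).
exists M => x /ltW/hM; rewrite ltr_pdivlMr// mulrC.
exact: le_lt_trans.
Qed.

Lemma dderiv_zero_const (k : R) : dderiv_zero (fun _ : R => k).
Proof.
move=> psi tpsi; have [M [M0 psi0 dpsi0]] := test_fun_support tpsi.
have ck : continuous (fun _ : R => k) by move=> x; exact: cvg_cst.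
rewrite (@integral_compact_support _ _ (fun x => k * psi x) M)//.
- by rewrite !psi0 ?normrN ?ler_norm// subrr.
- exact/continuousM_fun/smooth_continuous_derive1/tpsi.1.
- move=> x; apply: der_eq (derM (derC k x) (smooth_der tpsi.1 x)) _.
  by rewrite mul0r add0r.
- by move=> x /ltW/dpsi0 ->; rewrite mulr0.
Qed.

(** The bound [d] keeps [c - p] away from 0 and [C] controls [q] by [p], so that eta, phi' and eta'
    are all dominated by multiples of |p| and inherit square integrability from it. *)
Lemma profile_wave A c p q (d C : R) x0 : profile A c p q -> p x0 != 0 ->
  L2 p -> 0 < d -> (forall x, d <= `|c - p x|) -> 0 < C ->
  (forall x, `|q x| <= C * `|p x|) ->
  solitary_wave A c p (fun x => p x / (c - p x)).
Proof.
move=> pq px0 L2p d0 hd C0 hC.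
have hp := profile_der pq; have hq := profile_der2 pq.
have vp := profile_vanishes pq.
have cp : continuous p by exact: ders_continuous hp.
have cq : continuous q by exact: ders_continuous hq.
have c0 : c != 0.
  by apply/eqP => h; have := profile_lt pq 0; rewrite h mul0r ltxx.
have cpN0 x : c - p x != 0 by exact: profile_sub_neq0 pq.
pose eta x := p x / (c - p x).
have hcp x : has_der x (fun x => c - p x) (- q x).
  by apply: der_eq (derB (derC c x) (hp x)) _; rewrite sub0r.
have heta x : has_der x eta (c * q x * ((c - p x)^-1 * (c - p x)^-1)).
  apply: der_eq (derM (hp x) (@derV _ (fun x => c - p x) _ _ (cpN0 x) (hcp x))) _.
  by rewrite /=; have h := cpN0 x; field.
have inv_le x : `|c - p x|^-1 <= d^-1.
  by rewrite lef_pV2 ?posrE// normr_gt0.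
have cinv : continuous (fun x => (c - p x)^-1).
  exact: (ders_continuous (fun x => @derV _ (fun x => c - p x) _ _ (cpN0 x) (hcp x))).
have ceta : continuous eta by exact: ders_continuous heta.
have cdeta : continuous (fun x => c * q x * ((c - p x)^-1 * (c - p x)^-1)).
  apply: continuousM_fun; last exact: continuousM_fun.
  by apply: continuousM_fun => // x; exact: cvg_cst.
have eta_le x : `|eta x| <= d^-1 * `|p x|.
  by rewrite /eta normrM normfV mulrC ler_wpM2r.
have [B B0 hB] := vanishes_bounded cp vp.
have dV0 : 0 < d^-1 by rewrite invr_gt0.
have [B' B'0 hB'] := vanishes_bounded ceta (vanishes_le vp dV0 eta_le).
split; last split; last split; last split; last split; last split.
- split=> //; split=> //; exists q; split; last exact: weak_deriv_classical.
  exact: L2_le L2p cq hC.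
- split=> //; split; first exact: L2_le L2p ceta eta_le.
  exists (fun x => c * q x * ((c - p x)^-1 * (c - p x)^-1)).
  split; last exact: weak_deriv_classical.
  apply: (@L2_le p _ (`|c| * C * (d^-1 * d^-1))) => // x.
  rewrite !normrM normfV -mulrA [X in _ <= X]mulrAC -!mulrA.
  rewrite ler_wpM2l// [X in _ <= X]mulrA.
  by apply: ler_pM => //; rewrite ?mulr_ge0// ?invr_ge0//; apply: ler_pM; rewrite ?invr_ge0.
- by exists x0; left.
- exact: vp.
- by apply: vanishes_le vp _ eta_le; rewrite invr_gt0.
(* The profile equation says that v - v'' is the source, so the bounded function [v] is the
   convolution and the bracket to differentiate is the constant 1/2. *)
- pose v x := c * p x + 1 / 2; pose v1 x := c * q x.
  have vE : Defs.conv (@pker R) (wave_source A p eta) = v.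
    have cg := continuous_wave_source (A := A) cp ceta.
    have hg := wave_source_bounded A (addr_ge0 B0 B'0)
      (fun x => le_trans (hB x) (ler_wpDr B'0 (lexx _)))
      (fun x => le_trans (hB' x) (ler_wpDl B0 (lexx _))).
    apply/funext; apply: (@conv_pker_green _ _ v v1 _ (`|c| * B + `|c| * (C * B) + 1)
      cg hg).
    + move=> y; apply: der_eq (derD (derM (derC c y) (hp y)) (derC (1 / 2) y)) _.
      by rewrite /v1; ring.
    + move=> y; apply: der_eq (derM (derC c y) (hq y)) _.
      rewrite /v /wave_source /profile_rhs /eta /=.
      by have h := cpN0 y; field; rewrite h c0.
    + move=> y; rewrite /v (le_trans (ler_normD _ _))//.
      rewrite -addrA lerD//; first by rewrite normrM ler_wpM2l.
      rewrite (ger0_norm (_ : 0 <= 1 / 2 :> R)); last by lra.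
      have : 0 <= `|c| * (C * B) by rewrite !mulr_ge0// ltW.
      by lra.
    + move=> y; rewrite /v1 normrM.
      have h1 : `|c| * `|q y| <= `|c| * (C * B).
        by rewrite ler_wpM2l// (le_trans (hC y))// ler_wpM2l// ltW.
      have : 0 <= `|c| * B by rewrite mulr_ge0.
      by lra.
  rewrite (_ : (fun _ => _) = (fun=> 1 / 2)); first exact: dderiv_zero_const.
  apply/funext => x; rewrite -[Defs.conv _ _ _]/(Defs.conv (@pker R) (wave_source A p eta) x).
  by rewrite vE /v; ring.
- rewrite (_ : (fun _ => _) = (fun=> 0)); first exact: dderiv_zero_const.
  by apply/funext => x; have h := cpN0 x; field.
Qed.

End SquareIntegrable.

(** * Construction of profiles *)

Section ProfileExistence.
Variable R : realType.
Implicit Types (x t : R).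

(* Separation of variables: the solution is the inverse of a primitive of
   [1 / G]. *)
Lemma autonomous_solution (G : R -> R) (g0 g1 : R) : continuous G -> 0 < g0 ->
  (forall t, g0 <= G t) -> (forall t, G t <= g1) ->
  exists2 theta : R -> R, forall x, has_der x theta (G (theta x)) & theta 0 = 0.
Proof.
move=> cG g00 hg0 hg1.
have Gpos t : 0 < G t by exact: lt_le_trans (hg0 t).
have g10 : 0 < g1 by exact: lt_le_trans (hg1 0).
have cV : continuous (fun t => (G t)^-1).
  by move=> t; apply: (continuousV _ (cG t)); rewrite gt_eqF.
have [T0 hT0] := antiderivative cV.
pose T t := T0 t - T0 0.
have hT t : has_der t T (G t)^-1.
  by apply: der_eq (derB (hT0 t) (derC (T0 0) t)) _; rewrite subr0.
have T00 : T 0 = 0 by rewrite /T subrr.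
have cT : continuous T by exact: ders_continuous hT.
have T_lt s t : s < t -> T s < T t.
  move=> st; have [r [_ _ e]] := der_mvt st hT.
  by rewrite -subr_gt0 e mulr_gt0 ?invr_gt0// subr_gt0.
have Tinj : injective T.
  by move=> s t e; have [/T_lt|/T_lt|//] := ltgtP s t; rewrite e ltxx.
(* The derivative of [T] is at least 1/g1, so [T] grows at least linearly in both directions and is
   onto. *)
have hTg s t : s <= t -> T s - s / g1 <= T t - t / g1.
  apply: (@der_ge0_nondecreasing _ (fun t => T t - t / g1)
    (fun t => (G t)^-1 - (1 * g1^-1 + t * 0))) => r.
    by apply: derB; [exact: hT|exact: derM (derId r) (derC g1^-1 r)].
  by rewrite mul1r mulr0 addr0 subr_ge0 lef_pV2 ?posrE.
have Tsurj x : exists t, T t = x.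
  have tg : x * g1 / g1 = x by rewrite mulfK// gt_eqF.
  have [x0|x0] := leP 0 x.
    have h : 0 <= x * g1 by rewrite mulr_ge0// ltW.
    apply: (ivt h cT); first by rewrite T00.
    by have := hTg _ _ h; rewrite tg T00; lra.
  have h : x * g1 <= 0 by rewrite pmulr_lle0// ltW.
  apply: (ivt h cT); last by rewrite T00 ltW.
  by have := hTg _ _ h; rewrite tg T00; lra.
have [theta Ttheta] := choice Tsurj.
have thetaK t : theta (T t) = t by apply: Tinj; rewrite Ttheta.
exists theta; last by rewrite -{1}T00 thetaK.
move=> x; rewrite -{1}(Ttheta x) -[G _]invrK.
apply: is_derive_inverse; last by rewrite invr_eq0 gt_eqF.
- by near=> t; exact: thetaK.
- by near=> t; exact: cT.
- exact: hT.
Unshelve. all: by end_near. Qed.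

(** The hyperbolic tangent; 1 - th^2 is sech^2. *)
Definition th t : R := (expR t - expR (- t)) / (expR t + expR (- t)).

Lemma th_denom_gt0 t : 0 < expR t + expR (- t).
Proof. by rewrite addr_gt0 ?expR_gt0. Qed.

Lemma one_sub_sqr_th t : 1 - th t ^+ 2 = 4 / (expR t + expR (- t)) ^+ 2.
Proof.
rewrite /th expRN; have h : expR t != 0 by rewrite gt_eqF ?expR_gt0.
have h2 : expR t + (expR t)^-1 != 0 by rewrite -expRN gt_eqF ?th_denom_gt0.
have h3 : expR t ^+ 2 + 1 != 0.
  by rewrite gt_eqF// ltr_wpDl// sqr_ge0.
by field; rewrite ?h ?h3.
Qed.

Lemma th_der t : has_der t th (1 - th t ^+ 2).
Proof.
have hN : has_der t (fun t => expR (- t)) (- expR (- t)).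
  by apply: der_eq (der_expR (derN (derId t))) _; rewrite mulrN1.
have hE : has_der t (@expR R) (expR t) by exact: is_derive_expR.
have d0 : expR t + expR (- t) != 0 by rewrite gt_eqF ?th_denom_gt0.
apply: der_eq (derM (derB hE hN) (@derV _ (fun t => expR t + expR (- t)) _ _ d0
  (derD hE hN))) _.
by rewrite /th /=; field.
Qed.

Lemma one_sub_sqr_th_gt0 t : 0 < 1 - th t ^+ 2.
Proof. by rewrite one_sub_sqr_th divr_gt0// exprn_gt0 ?th_denom_gt0. Qed.

(** A crude decay rate from e^|t| >= 1 + |t|; it is enough for the profile to vanish at infinity. *)
Lemma one_sub_sqr_th_le t : (1 - th t ^+ 2) * `|t| <= 4.
Proof.
rewrite one_sub_sqr_th mulrAC ler_pdivrMr ?exprn_gt0 ?th_denom_gt0//.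
rewrite ler_pM2l//.
have e1 := expR_ge1Dx t; have e2 := expR_ge1Dx (- t).
have p1 := expR_gt0 t; have p2 := expR_gt0 (- t).
have [t0|t0] := leP 0 t; first by rewrite (ger0_norm t0); nra.
by rewrite (ltr0_norm t0); nra.
Qed.

(* With [A = 1/a - a] the first integral reads
   [phi'^2 = phi^2 (m - phi) (c + 1/a - phi) / (c (c - phi))], [m = c - a].
   The substitution [phi = m (1 - th(theta)^2)] removes the square-root
   singularity at the crest and leaves [theta' = sqrt (S phi)]. *)
Lemma profile_exists (a c : R) : 0 < a -> a < c ->
  exists p q (C : R), [/\ profile (a^-1 - a) c p q, forall x, 0 < p x,
    L2 p, forall x, a <= c - p x & 0 < C /\ forall x, `|q x| <= C * `|p x|].
Proof.
move=> a0 ac; pose m : R := c - a.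
have m0 : 0 < m by rewrite /m; lra.
have c0 : 0 < c by lra.
have aN0 : a != 0 by rewrite gt_eqF.
have cN0 : c != 0 by rewrite gt_eqF.
have mN0 : m != 0 by rewrite gt_eqF.
(* With phi = z(theta), z' = -2 th z and m - z = m th^2, the factor th^2 cancels from the first
   integral and leaves theta'^2 = m (c + 1/a - phi) / (4 c (c - phi)), which is [S phi]. *)
pose k : R := m / (4 * c).
have k0 : 0 < k by rewrite divr_gt0// mulr_gt0.
pose z (t : R) : R := m * (1 - th t ^+ 2).
pose S (w : R) : R := k * (1 + (a * (c - w))^-1).
have z0 t : 0 < z t by rewrite mulr_gt0// one_sub_sqr_th_gt0.
have zm t : z t <= m by rewrite /z ger_pMr// gerBl sqr_ge0.
have cz t : a <= c - z t by have := zm t; rewrite /m; lra.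
have czN0 t : c - z t != 0 by rewrite gt_eqF// (lt_le_trans a0).
have Sk t : k <= S (z t).
  rewrite /S ler_pMr// lerDl invr_ge0 mulr_ge0// ltW//.
  exact: lt_le_trans (cz t).
have S_gt0 t : 0 < S (z t) by exact: lt_le_trans (Sk t).
have Sle t : S (z t) <= k * (1 + (a * a)^-1).
  rewrite /S ler_pM2l// lerD2l lef_pV2 ?posrE ?mulr_gt0// ?ler_pM2l//.
  exact: lt_le_trans (cz t).
have hz t : has_der t z (- 2 * th t * z t).
  apply: der_eq (derM (derC m t) (derB (derC 1 t) (derX 2 (th_der t)))) _.
  by rewrite /z /=; ring.
have hS t : has_der t (fun t => S (z t))
    (k * (a * (c - z t) ^+ 2)^-1 * (- 2 * th t * z t)).
  have h : a * (c - z t) != 0 by rewrite mulf_neq0.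
  have hcz := derM (derC a t) (derB (derC c t) (hz t)).
  apply: der_eq (derM (derC k t) (derD (derC 1 t)
    (@derV _ (fun t => a * (c - z t)) _ _ h hcz))) _.
  by have h' := czN0 t; rewrite /=; field; rewrite h' aN0.
pose G (t : R) : R := Num.sqrt (S (z t)).
have G0 t : 0 < G t by rewrite sqrtr_gt0.
have GG t : G t ^+ 2 = S (z t) by rewrite sqr_sqrtr// ltW.
have hG t : has_der t G (- k * (a * (c - z t) ^+ 2)^-1 * th t * z t / G t).
  have := @der_comp _ (fun t => S (z t)) Num.sqrt t _ _
    (is_derive1_sqrt (S_gt0 t)) (hS t).
  move=> h; apply: der_eq h _; rewrite -/(G t).
  by have h' := czN0 t; have := G0 t; move=> /gt_eqF/negbT h''; field; rewrite h' h'' aN0.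
pose g0 : R := Num.sqrt k.
have g00 : 0 < g0 by rewrite sqrtr_gt0.
have Gg0 t : g0 <= G t by rewrite ler_wsqrtr.
pose g1 : R := Num.sqrt (k * (1 + (a * a)^-1)).
have Gg1 t : G t <= g1 by rewrite ler_wsqrtr.
have [theta hth th0] := autonomous_solution (ders_continuous hG) g00 Gg0 Gg1.
pose y (x : R) : R := th (theta x); pose p (x : R) : R := z (theta x).
pose q (x : R) : R := - 2 * y x * p x * G (theta x).
have hy x : has_der x y ((1 - y x ^+ 2) * G (theta x)).
  exact: (der_comp (th_der (theta x)) (hth x)).
have hp x : has_der x p (q x).
  exact: (der_comp (hz (theta x)) (hth x)).
have y1 x : `|y x| <= 1.
  have := one_sub_sqr_th_gt0 (theta x); rewrite -/(y x) ler_norml; nra.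
have qp x : `|q x| <= (2 * g1) * `|p x|.
  rewrite /q (normrM (- 2 * y x * p x)) (normrM (- 2 * y x)) (normrM (- 2)).
  rewrite normrN (ger0_norm (ler0n R 2)) (gtr0_norm (G0 _)).
  have h : `|y x| * G (theta x) <= 1 * g1 by rewrite ler_pM// ltW.
  rewrite (_ : _ * _ = 2 * `|p x| * (`|y x| * G (theta x))); last by ring.
  rewrite (_ : 2 * g1 * _ = 2 * `|p x| * (1 * g1)); last by ring.
  by rewrite ler_wpM2l// mulr_ge0.
have g10 : 0 < 2 * g1 by rewrite mulr_gt0// (lt_le_trans (G0 0)).
have theta_nd s t : s <= t -> theta s - g0 * s <= theta t - g0 * t.
  apply: (@der_ge0_nondecreasing _ (fun t => theta t - g0 * t)
    (fun t => G (theta t) - (0 * t + g0 * 1))) => r.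
    by apply: derB; [exact: hth|exact: derM (derC g0 r) (derId r)].
  by rewrite mul0r add0r mulr1 subr_ge0.
have theta_ge x : g0 * `|x| <= `|theta x|.
  have [x0|/ltW x0] := leP 0 x.
    rewrite (ger0_norm x0) (le_trans _ (ler_norm _))//.
    by have := theta_nd _ _ x0; rewrite th0; lra.
  rewrite (ler0_norm x0) -normrN (le_trans _ (ler_norm _))//.
  by have := theta_nd _ _ x0; rewrite th0; lra.
have vp : vanishes_at_infty p.
  apply: eps_vanishes => e e0; exists (4 * m / (g0 * e)) => x.
  rewrite ltr_pdivrMr ?mulr_gt0// => hx.
  rewrite gtr0_norm ?z0//.
  have h1 : p x * (g0 * `|x|) <= m * 4.
    rewrite (le_trans (ler_wpM2l (ltW (z0 _)) (theta_ge x)))//.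
    by rewrite /p /z -mulrA ler_pM2l// one_sub_sqr_th_le.
  have xg0 : 0 < g0 * `|x|.
    rewrite mulr_gt0// normr_gt0; apply: contraTneq hx => ->.
    by rewrite normr0 mul0r -leNgt mulr_ge0// ltW.
  by rewrite -(ltr_pM2r xg0) (le_lt_trans h1)// mulrC (lt_le_trans hx)//
    mulrCA mulrA mulrC mulrA lexx.
have pN0 x : c - p x != 0 by exact: czN0.
have hq x : has_der x q (profile_rhs (a^-1 - a) c (p x)).
  have hGt := @der_comp _ theta G x _ _ (hG (theta x)) (hth x).
  apply: der_eq (derM (derM (derM (derC (- 2) x) (hy x)) (hp x)) hGt) _.
  have GN0 : G (theta x) != 0 by rewrite gt_eqF.
  have y2 : y x ^+ 2 = 1 - p x / m by rewrite /p /z -/(y x); field.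
  rewrite -/(y x) -/(p x) /q.
  (* Only even powers of [y] and [G] remain, so G^2 = S(p) and y^2 = 1 - p/m reduce the claim to a
     rational identity in [p]. *)
  transitivity (G (theta x) ^+ 2 * (p x * (4 * y x ^+ 2 - 2 * (1 - y x ^+ 2))) +
      2 * (k * (a * (c - p x) ^+ 2)^-1) * y x ^+ 2 * p x ^+ 2).
    by have := pN0 x; move: (p x) (y x) (G _) GN0 => P Y g gN0 PN0;
       field; rewrite gN0 PN0 aN0.
  rewrite GG -/(p x) y2 /S /k /profile_rhs.
  move: mN0 (pN0 x); rewrite /m; move: (p x) => P mN0' PN0.
  by field; rewrite mN0' PN0 cN0 aN0.
(* The right-hand side is a multiple of y', and |y| <= 1, so p^2 is integrable. *)
have p2_le x : p x ^+ 2 <= m ^+ 2 / g0 * ((1 - y x ^+ 2) * G (theta x)).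
  have -> : p x = m * (1 - y x ^+ 2) by [].
  have := one_sub_sqr_th_gt0 (theta x); rewrite -/(y x).
  have := sqr_ge0 (y x); move: (y x ^+ 2) => Y Y0 Y1.
  have -> : (m * (1 - Y)) ^+ 2 = m ^+ 2 / g0 * ((1 - Y) * ((1 - Y) * g0)).
    by field; rewrite gt_eqF.
  rewrite ler_wpM2l ?divr_ge0 ?sqr_ge0 ?(ltW g00)//.
  rewrite (ler_pM2l Y1) (le_trans _ (Gg0 _))// ler_piMl ?(ltW g00)//.
  by lra.
exists p, q, (2 * g1); split => //.
- split => //; first by move=> x; rewrite mulr_gt0// (lt_le_trans a0)// cz.
  exact: (vanishes_le vp g10 qp).1.
- by move=> x; exact: z0.
- have cp : continuous p by exact: ders_continuous hp.
  split; last exact: continuous_measurable_fun.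
  have cy' : continuous (fun x => (1 - y x ^+ 2) * G (theta x)).
    rewrite (_ : (fun _ => _) = (fun x => p x / m * G (theta x))); last first.
      by apply/funext => x; rewrite /p /z -/(y x); field.
    apply: continuousM_fun.
      by apply: continuousM_fun => // x; exact: cvg_cst.
    exact: (ders_continuous (fun x => @der_comp _ theta G x _ _ (hG (theta x)) (hth x))).
  have y'0 x : 0 <= (1 - y x ^+ 2) * G (theta x).
    by rewrite mulr_ge0 ?ltW// one_sub_sqr_th_gt0.
  have := integrableZl (@measurableT _ _) (m ^+ 2 / g0)
    (ge0_integrable_bounded_primitive cy' y'0 hy y1).
  apply: le_integrable => //.
    apply/measurable_EFinP; apply: measurable_funX.
    exact: continuous_measurable_fun.
  move=> x _; rewrite -EFinM !abse_EFin lee_fin !ger0_norm ?sqr_ge0//; last first.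
    by apply: mulr_ge0 (y'0 x); rewrite divr_ge0 ?sqr_ge0// ltW.
- by move=> x; exact: cz.
Qed.

End ProfileExistence.

(** * Existence of waves at admissible speeds *)

Section WaveExistence.
Variable R : realType.
Implicit Types (A c : R).

(** The threshold is the positive root of t^2 + A t - 1; dividing by the root puts [A] in the form
    required by [profile_exists]. *)
Lemma speed_threshold A (a : R) : a = (- A + Num.sqrt (A ^+ 2 + 4)) / 2 ->
  0 < a /\ a^-1 - a = A.
Proof.
have := sqrt_disc_gt A; have := sqr_sqrt_disc A.
set s : R := Num.sqrt _ => s2; rewrite ltr_norml => /andP[s1 s3] ->.
have a0 : 0 < (- A + s) / 2 by lra.
split=> //; apply/eqP; rewrite subr_eq; apply/eqP.
have aN0 : (- A + s) / 2 != 0 by rewrite gt_eqF.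
apply: (mulIf aN0); rewrite mulVf//.
transitivity ((s ^+ 2 - A ^+ 2) / 4); last by field.
by rewrite s2; field.
Qed.

Lemma wave_exists A c :
  (- A + Num.sqrt (A ^+ 2 + 4)) / 2 < c \/
  c < (- A - Num.sqrt (A ^+ 2 + 4)) / 2 ->
  exists phi eta : R -> R, solitary_wave A c phi eta.
Proof.
case=> hc.
  have [a0 aA] := speed_threshold (erefl ((- A + Num.sqrt (A ^+ 2 + 4)) / 2)).
  have [p [q [C []]]] := profile_exists a0 hc; rewrite aA => pq p0 L2p cp [C0 qp].
  exists p, (fun x => p x / (c - p x)).
  apply: (@profile_wave _ A c p q _ C 0 pq _ L2p a0) => //; first by rewrite gt_eqF.
  by move=> x; rewrite (le_trans (cp x))// ler_norm.
(* For the reflected parameters -A and -c the threshold is a = -A2, so c < A2 becomes a < -c. *)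
have := speed_threshold (erefl ((- - A + Num.sqrt ((- A) ^+ 2 + 4)) / 2)).
rewrite sqrrN opprK; set a := _ / 2 => -[a0 aA].
have {}hc : a < - c by rewrite /a; lra.
have [p [q [C []]]] := profile_exists a0 hc; rewrite aA => pq p0 L2p cp [C0 qp].
have cont_p : continuous p by exact: ders_continuous (profile_der pq).
have {}pq := profileN pq; rewrite !opprK in pq.
exists (fun x => - p x), (fun x => - p x / (c - - p x)).
apply: (@profile_wave _ A c _ _ a C 0 pq _ _ a0) => //.
- by rewrite oppr_eq0 gt_eqF.
- apply: (@L2_le _ p _ 1) => //; first by move=> x; exact: (continuousN (cont_p x)).
  by move=> x; rewrite mul1r normrN.
- by move=> x; rewrite -normrN opprD opprK (le_trans _ (ler_norm _)).
- by move=> x; rewrite !normrN.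
Qed.

End WaveExistence.

Theorem theorem2p5 (R : realType) (A : R) (hA : 0 < A) :
  let A1 := (- A + Num.sqrt (A ^+ 2 + 4)) / 2 in
  let A2 := (- A - Num.sqrt (A ^+ 2 + 4)) / 2 in
  (forall c : R, (exists phi eta : R -> R, solitary_wave A c phi eta)
                 <-> (A1 < c \/ c < A2)) /\
  (forall (c : R) (phi eta : R -> R), solitary_wave A c phi eta ->
     smooth phi /\ smooth eta).
Proof.
split=> [c|c phi eta]; last exact: wave_smooth.
by split=> [[phi [eta]]|]; [exact: wave_speed|exact: wave_exists].
Qed.
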